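(* Let $L/K$ be a field extension of odd degree with $\mathrm{char}\,K\neq 2$, and let $\epsilon=\pm1$. Let $(\mathscr{C},*,\omega)$ be a $K$-linear hermitian category such that $\dim_K\mathrm{Hom}(M,M')$ is finite for all $M,M'\in\mathscr{C}$. Then the map $W^{\epsilon}(\mathscr{C})\to W^{\epsilon}(\mathscr{C}_L)$ induced by the scalar extension functor $\mathcal{R}_{L/K}$ (i.e. by $(M,s)\mapsto(M_L,s_L)$) is injective.
   Context: A hermitian category is a triple $(\mathscr{C},*,\omega)$ with $\mathscr{C}$ additive, $*:\mathscr{C}\to\mathscr{C}$ an (additive) contravariant functor and $\omega:\mathrm{id}\to **$ a natural transformation (not necessarily an isomorphism) with $\omega_C^*\,\omega_{C^*}=\mathrm{id}_{C^*}$ for all $C$. An object $C$ is reflexive if $\omega_C$ is an isomorphism. The hermitian category is $K$-linear if $\mathscr{C}$ is a $K$-category (Hom-sets are $K$-modules, composition $K$-bilinear) and $*$ is $K$-linear. A sesquilinear form over $\mathscr{C}$ is a pair $(C,s)$ with $s:C\to C^*$. It is unimodular if $s$ and $s^*\omega_C$ are isomorphisms, $\epsilon$-hermitian if $s=\epsilon s^*\omega_C$. An isometry $(C,s)\to(C',s')$ is an isomorphism $f:C\to C'$ with $s=f^*s'f$. $W^\epsilon(\mathscr{C})$ is the quotient of the Grothendieck group (with respect to orthogonal sum) of isometry classes of unimodular $\epsilon$-hermitian forms over $\mathscr{C}$ by the subgroup generated by the hyperbolic forms, i.e. those isometric to $\left(Q\oplus Q^*,\begin{bmatrix}0&\mathrm{id}_{Q^*}\\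 \epsilon\omega_Q&0\end{bmatrix}\right)$ with $Q$ a reflexive object. Scalar extension: $\mathscr{C}_L=\mathscr{C}\otimes_K L$ has objects formal symbols $C_L$ ($C\in\mathscr{C}$), $\mathrm{Hom}_{\mathscr{C}_L}(A_L,B_L)=\mathrm{Hom}_{\mathscr{C}}(A,B)\otimes_KL$, obvious composition, and hermitian structure $(C_L)^*=(C^* )_L$, $(f\otimes a)^*=f^*\otimes a$, $\omega_{C_L}=\omega_C\otimes1$. For $(M,s)$ over $\mathscr{C}$, $\mathcal{R}_{L/K}(M,s)=(M_L,s_L)$ with $s_L=s\otimes1$. *)

(* Defs.v *)
From HB Require Import structures.
From mathcomp Require Import all_boot all_order all_algebra all_field.
From mathcomp Require Import ring_quotient boolp.

Set Implicit Arguments.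
Unset Strict Implicit.
Unset Printing Implicit Defensive.

Import GRing.Theory.

Local Open Scope ring_scope.
Local Open Scope quotient_scope.

(* Quotient of an arbitrary type by a Prop-valued equivalence relation.  The
   relation is bundled so that the canonical instances on [cquot r] do not
   depend on side proofs. *)

Record prop_equiv (T : Type) := PropEquiv {
  pe_rel :> T -> T -> Prop;
  pe_refl : forall x, pe_rel x x;
  pe_sym : forall x y, pe_rel x y -> pe_rel y x;
  pe_trans : forall x y z, pe_rel x y -> pe_rel y z -> pe_rel x z }.

Section ClassicalQuotient.
Variables (T : Type) (r : prop_equiv T).

Definition pe_brel : rel {classic T} := fun x y => `[< r x y >].

Lemma pe_brel_equiv : equiv_class_of pe_brel.
Proof.
split=> [x|x y|y x z]; rewrite /pe_brel.
- exact/asboolP/pe_refl.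
- by apply/asboolP/asboolP; apply: pe_sym.
- by move=> /asboolP h /asboolP h'; apply/asboolP; apply: pe_trans h h'.
Qed.

Canonical pe_equiv_rel := EquivRelPack pe_brel_equiv.

Definition cquot : Type := {eq_quot pe_equiv_rel}.
HB.instance Definition _ := Choice.on cquot.

Definition cls (x : T) : cquot := \pi_({eq_quot pe_equiv_rel}) (x : {classic T}).
Definition rep (q : cquot) : T := repr (q : {eq_quot pe_equiv_rel}).

Lemma repK q : cls (rep q) = q. Proof. exact: reprK. Qed.

Lemma clsP x y : cls x = cls y <-> r x y.
Proof. by split=> [/eqmodP/asboolP|h]; [|apply/eqmodP/asboolP]. Qed.

Lemma rep_cls x : r (rep (cls x)) x.
Proof. by apply/clsP; rewrite repK. Qed.

Lemma cls_surj (q : cquot) : exists x, q = cls x.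
Proof. by exists (rep q); rewrite repK. Qed.

End ClassicalQuotient.

(* V (x)_K W : finite formal sums of pairs, modulo the congruence generated by
   commutativity, biadditivity and K-balancedness. *)

Section Tensor.
Variables (K : fieldType) (V W : lmodType K).

Inductive tens_rel : seq (V * W) -> seq (V * W) -> Prop :=
| TensRefl s : tens_rel s s
| TensSym s t : tens_rel s t -> tens_rel t s
| TensTrans s t u : tens_rel s t -> tens_rel t u -> tens_rel s u
| TensCat s s' t t' :
    tens_rel s s' -> tens_rel t t' -> tens_rel (s ++ t) (s' ++ t')
| TensCatC s t : tens_rel (s ++ t) (t ++ s)
| Tens0l w : tens_rel [:: (0, w)] [::]
| TensDl v v' w : tens_rel [:: (v + v', w)] [:: (v, w); (v', w)]
| TensDr v w w' : tens_rel [:: (v, w + w')] [:: (v, w); (v, w')]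
| TensZ a v w : tens_rel [:: (a *: v, w)] [:: (v, a *: w)].

Definition tens_equiv := PropEquiv TensRefl TensSym TensTrans.

Definition tensor : Type := cquot tens_equiv.
HB.instance Definition _ := Choice.on tensor.

Definition tens_cls (s : seq (V * W)) : tensor := cls tens_equiv s.
Definition tens_rep (x : tensor) : seq (V * W) := rep x.
Definition tens (v : V) (w : W) : tensor := tens_cls [:: (v, w)].

Lemma tens_clsP s t : tens_cls s = tens_cls t <-> tens_rel s t.
Proof. exact: (@clsP _ tens_equiv). Qed.

Lemma tens_cls_surj x : exists s, x = tens_cls s.
Proof. exact: cls_surj. Qed.

Lemma tens_repK x : tens_cls (tens_rep x) = x.
Proof. exact: repK. Qed.

Definition tensor_zero : tensor := tens_cls [::].
Definition tensor_add (x y : tensor) : tensor := tens_cls (tens_rep x ++ tens_rep y).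
Definition tensor_opp (x : tensor) : tensor :=
  tens_cls [seq (- p.1, p.2) | p <- tens_rep x].

Let addE s t : tensor_add (tens_cls s) (tens_cls t) = tens_cls (s ++ t).
Proof. by apply/tens_clsP/TensCat; apply: (@rep_cls _ tens_equiv). Qed.

Let addA : associative tensor_add.
Proof.
move=> x y z; have [s ->] := tens_cls_surj x; have [t ->] := tens_cls_surj y.
by have [u ->] := tens_cls_surj z; rewrite !addE catA.
Qed.

Let addC : commutative tensor_add.
Proof.
move=> x y; have [s ->] := tens_cls_surj x; have [t ->] := tens_cls_surj y.
by rewrite !addE; apply/tens_clsP/TensCatC.
Qed.

Let add0 : left_id tensor_zero tensor_add.
Proof. by move=> x; have [s ->] := tens_cls_surj x; rewrite addE. Qed.

Let addN : left_inverse tensor_zero tensor_opp tensor_add.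
Proof.
move=> x; rewrite -{2}[x]tens_repK /tensor_opp addE -/(tens_rep x).
elim: (tens_rep x) => [//|[v w] s ihs] /=; apply/tens_clsP.
pose s' := [seq (- p.1, p.2) | p <- s]; rewrite -/s'.
apply: (TensTrans (t := [:: (- v, w); (v, w)] ++ (s' ++ s))).
  apply: (TensCat (s := [:: (- v, w)]) (s' := [:: (- v, w)])
    (t := s' ++ [:: (v, w)] ++ s) (t' := [:: (v, w)] ++ s' ++ s)).
    exact: TensRefl.
  by rewrite !catA; apply: TensCat; [apply: TensCatC | apply: TensRefl].
rewrite -[[::]]/([::] ++ [::]); apply: TensCat; last exact/tens_clsP.
apply: (TensTrans (t := [:: (- v + v, w)])); first exact/TensSym/TensDl.
by rewrite addNr; apply: Tens0l.
Qed.

HB.instance Definition _ := GRing.isZmodule.Build tensor addA addC add0 addN.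

Lemma cls_tens_cat s t :
  tens_cls (s ++ t) = tens_cls s + tens_cls t :> tensor.
Proof. by rewrite -addE. Qed.

Lemma cls_tensE s :
  tens_cls s = \sum_(p <- s) tens p.1 p.2 :> tensor.
Proof.
elim: s => [|[v w] s ihs]; first by rewrite big_nil.
by rewrite big_cons -cat1s cls_tens_cat ihs.
Qed.

Lemma tens_ind (P : tensor -> Prop) :
  P 0 -> (forall x y, P x -> P y -> P (x + y)) ->
  (forall v w, P (tens v w)) -> forall x, P x.
Proof.
move=> P0 PD Pt x; have [s ->] := tens_cls_surj x; rewrite cls_tensE.
by elim/big_ind: _ => // p _; apply: Pt.
Qed.

Lemma tensDl v v' w : tens (v + v') w = tens v w + tens v' w.
Proof. by rewrite -cls_tens_cat; apply/tens_clsP/TensDl. Qed.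

Lemma tensDr v w w' : tens v (w + w') = tens v w + tens v w'.
Proof. by rewrite -cls_tens_cat; apply/tens_clsP/TensDr. Qed.

Lemma tensZ a v w : tens (a *: v) w = tens v (a *: w).
Proof. exact/tens_clsP/TensZ. Qed.

Definition balanced (U : zmodType) (f : V -> W -> U) :=
  [/\ forall v v' w, f (v + v') w = f v w + f v' w,
      forall v w w', f v (w + w') = f v w + f v w'
    & forall a v w, f (a *: v) w = f v (a *: w)].

Definition tens_lift (U : zmodType) (f : V -> W -> U) (x : tensor) : U :=
  \sum_(p <- tens_rep x) f p.1 p.2.

Section Lift.
Variables (U : zmodType) (f : V -> W -> U).
Hypothesis fb : balanced f.

Lemma tens_lift_cls s :
  tens_lift f (tens_cls s) = \sum_(p <- s) f p.1 p.2.
Proof.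
have [fD fD' fZ] := fb; rewrite /tens_lift.
have: tens_rel (tens_rep (tens_cls s)) s by apply: (@rep_cls _ tens_equiv).
move: (tens_rep _) => t; elim=> {s t} //=.
- by move=> s1 s2 s3 _ -> _.
- by move=> s1 s2 t1 t2 _ e1 _ e2; rewrite !big_cat /= e1 e2.
- by move=> s1 s2; rewrite !big_cat /= addrC.
- move=> w; rewrite big_seq1 big_nil /=.
  by apply: (addrI (f 0 w)); rewrite -fD !addr0.
- by move=> v v' w; rewrite big_seq1 big_cons big_seq1 /= ?fD ?fD'.
- by move=> v w w'; rewrite big_seq1 big_cons big_seq1 /= ?fD ?fD'.
- by move=> a v w; rewrite !big_seq1 /= fZ.
Qed.

Lemma tens_liftE v w : tens_lift f (tens v w) = f v w.
Proof. by rewrite tens_lift_cls big_seq1. Qed.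

Lemma tens_liftD x y : tens_lift f (x + y) = tens_lift f x + tens_lift f y.
Proof.
have [s ->] := tens_cls_surj x; have [t ->] := tens_cls_surj y.
by rewrite -cls_tens_cat !tens_lift_cls big_cat.
Qed.

End Lift.

Lemma tens_lift_add (U : zmodType) (f g : V -> W -> U) x :
  tens_lift (fun v w => f v w + g v w) x = tens_lift f x + tens_lift g x.
Proof. exact: big_split. Qed.

Lemma eq_tens_lift (U : zmodType) (f g : V -> W -> U) x :
  (forall v w, f v w = g v w) -> tens_lift f x = tens_lift g x.
Proof. by move=> e; apply: eq_bigr => p _. Qed.

End Tensor.

Lemma morphMz (U V : zmodType) (f : U -> V) :
  {morph f : x y / x + y} -> forall x n, f (x *~ n) = f x *~ n.
Proof.
move=> fD x n.
have fB : zmod_morphism f by move=> y z; apply: (addIr (f z)); rewrite -fD !subrK.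
pose fM := GRing.isZmodMorphism.Build U V f fB.
pose F : {additive U -> V} := HB.pack f fM.
exact: (raddfMz F).
Qed.

(* Additive categories.  Zero object and binary biproducts are chosen; every
   construction below is independent of the choice up to isometry. *)

Record addCat := AddCat {
  obj :> Type;
  hom : obj -> obj -> zmodType;
  idm : forall A, hom A A;
  comp : forall A B C, hom B C -> hom A B -> hom A C;
  compA : forall A B C D (h : hom C D) (g : hom B C) (f : hom A B),
    comp h (comp g f) = comp (comp h g) f;
  comp1m : forall A B (f : hom A B), comp (idm B) f = f;
  compm1 : forall A B (f : hom A B), comp f (idm A) = f;
  compDl : forall A B C (g g' : hom B C) (f : hom A B),
    comp (g + g') f = comp g f + comp g' f;
  compDr : forall A B C (g : hom B C) (f f' : hom A B),
    comp g (f + f') = comp g f + comp g f';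
  zobj : obj;
  idm_zobj : idm zobj = 0;
  bip : obj -> obj -> obj;
  in1 : forall A B, hom A (bip A B);
  in2 : forall A B, hom B (bip A B);
  pr1 : forall A B, hom (bip A B) A;
  pr2 : forall A B, hom (bip A B) B;
  pr1_in1 : forall A B, comp (pr1 A B) (in1 A B) = idm A;
  pr2_in2 : forall A B, comp (pr2 A B) (in2 A B) = idm B;
  pr1_in2 : forall A B, comp (pr1 A B) (in2 A B) = 0;
  pr2_in1 : forall A B, comp (pr2 A B) (in1 A B) = 0;
  bip_id : forall A B,
    comp (in1 A B) (pr1 A B) + comp (in2 A B) (pr2 A B) = idm (bip A B) }.

Arguments idm {_}.
Arguments zobj {_}.
Arguments in1 {_}.
Arguments in2 {_}.
Arguments pr1 {_}.
Arguments pr2 {_}.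

Notation "g \oc f" := (comp g f)
  (at level 40, left associativity, format "g  \oc  f").

Section AddCatTheory.
Variable C : addCat.
Implicit Types A B D : C.

Definition is_iso A B (f : hom A B) :=
  exists g : hom B A, g \oc f = idm A /\ f \oc g = idm B.

Lemma compm0 A B D (g : hom B D) : g \oc (0 : hom A B) = 0.
Proof. by apply: (addrI (g \oc 0)); rewrite -compDr !addr0. Qed.

Lemma comp0m A B D (f : hom A B) : (0 : hom B D) \oc f = 0.
Proof. by apply: (addrI (0 \oc f)); rewrite -compDl !addr0. Qed.

Lemma compMzl A B D (g : hom B D) (f : hom A B) n :
  (g *~ n) \oc f = (g \oc f) *~ n.
Proof. exact: (morphMz (fun g g' => compDl g g' f)). Qed.

Lemma compMzr A B D (g : hom B D) (f : hom A B) n :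
  g \oc (f *~ n) = (g \oc f) *~ n.
Proof. exact: (morphMz (compDr g)). Qed.

Lemma is_iso_id A : is_iso (idm A).
Proof. by exists (idm A); rewrite comp1m. Qed.

Lemma is_iso_comp A B D (g : hom B D) (f : hom A B) :
  is_iso g -> is_iso f -> is_iso (g \oc f).
Proof.
move=> [g' [g'g gg']] [f' [f'f ff']]; exists (f' \oc g'); split.
  by rewrite compA -(compA f') g'g compm1.
by rewrite compA -(compA g) ff' compm1.
Qed.

Lemma bip_ext A B D (f g : hom D (bip A B)) :
  pr1 A B \oc f = pr1 A B \oc g -> pr2 A B \oc f = pr2 A B \oc g -> f = g.
Proof.
move=> e1 e2; rewrite -(comp1m f) -(comp1m g) -bip_id !compDl -!compA.
by rewrite e1 e2.
Qed.

Definition pair_m A B D (f : hom D A) (g : hom D B) : hom D (bip A B) :=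
  in1 A B \oc f + in2 A B \oc g.

Lemma pr1_pair A B D (f : hom D A) (g : hom D B) : pr1 A B \oc pair_m f g = f.
Proof. by rewrite compDr !compA pr1_in1 pr1_in2 comp1m comp0m addr0. Qed.

Lemma pr2_pair A B D (f : hom D A) (g : hom D B) : pr2 A B \oc pair_m f g = g.
Proof. by rewrite compDr !compA pr2_in1 pr2_in2 comp1m comp0m add0r. Qed.

End AddCatTheory.

Record hermCat := HermCat {
  hcat :> addCat;
  dual : hcat -> hcat;
  dualm : forall A B : hcat, hom A B -> hom (dual B) (dual A);
  dualm1 : forall A : hcat, dualm (idm A) = idm (dual A);
  dualmM : forall (A B C : hcat) (g : hom B C) (f : hom A B),
    dualm (g \oc f) = dualm f \oc dualm g;
  dualmD : forall (A B : hcat) (f f' : hom A B),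
    dualm (f + f') = dualm f + dualm f';
  omega : forall A : hcat, hom A (dual (dual A));
  omega_nat : forall (A B : hcat) (f : hom A B),
    omega B \oc f = dualm (dualm f) \oc omega A;
  omega_dual : forall A : hcat,
    dualm (omega A) \oc omega (dual A) = idm (dual A) }.

Arguments omega {_}.

Definition reflexive_obj (C : hermCat) (Q : C) := is_iso (omega Q).

Record linHermCat (K : fieldType) := LinHermCat {
  lcat :> hermCat;
  hscale : forall A B : lcat, K -> hom A B -> hom A B;
  hscaleA : forall (A B : lcat) a b (f : hom A B),
    hscale a (hscale b f) = hscale (a * b) f;
  hscale1 : forall (A B : lcat) (f : hom A B), hscale 1 f = f;
  hscaleDr : forall (A B : lcat) a (f g : hom A B),
    hscale a (f + g) = hscale a f + hscale a g;
  hscaleDl : forall (A B : lcat) (f : hom A B) a b,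
    hscale (a + b) f = hscale a f + hscale b f;
  comp_scalel : forall (A B C : lcat) a (g : hom B C) (f : hom A B),
    hscale a g \oc f = hscale a (g \oc f);
  comp_scaler : forall (A B C : lcat) a (g : hom B C) (f : hom A B),
    g \oc hscale a f = hscale a (g \oc f);
  dualm_scale : forall (A B : lcat) a (f : hom A B),
    dualm (hscale a f) = hscale a (dualm f) }.

(* Alias of [hom A B] carrying the K-module structure given by [hscale]. *)
Definition lhom (K : fieldType) (C : linHermCat K) (A B : C) : Type := hom A B.

HB.instance Definition _ (K : fieldType) (C : linHermCat K) (A B : C) :=
  GRing.Zmodule.on (@lhom K C A B).
HB.instance Definition _ (K : fieldType) (C : linHermCat K) (A B : C) :=
  GRing.Zmodule_isLmodule.Build K (@lhom K C A B)
    (@hscaleA K C A B) (@hscale1 K C A B) (@hscaleDr K C A B) (@hscaleDl K C A B).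

(* [Vector.axiom n V] is the type of K-linear bijections V -> K^n. *)
Definition finite_dim (K : fieldType) (V : lmodType K) :=
  exists n : nat, inhabited (Vector.axiom n V).

Section Forms.
Variable C : hermCat.
Implicit Types A B : C.

Lemma dualm0 A B : dualm (0 : hom A B) = 0.
Proof. by apply: (addrI (dualm 0)); rewrite -dualmD !addr0. Qed.

Lemma dualmMz A B (f : hom A B) n : dualm (f *~ n) = dualm f *~ n.
Proof. exact: (morphMz (@dualmD C A B)). Qed.

Record sform := SForm { sobj : C; smap : hom sobj (dual sobj) }.

Definition adjoint (s : sform) : hom (sobj s) (dual (sobj s)) :=
  dualm (smap s) \oc omega (sobj s).

Definition unimodular (s : sform) := is_iso (smap s) /\ is_iso (adjoint s).

Definition eps_hermitian (eps : int) (s : sform) := smap s = adjoint s *~ eps.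

Definition is_isometry (s t : sform) (f : hom (sobj s) (sobj t)) :=
  is_iso f /\ smap s = dualm f \oc smap t \oc f.

Definition isometric (s t : sform) := exists f, @is_isometry s t f.

(* s (+) t under the identification (A (+) B)^* = A^* (+) B^*. *)
Definition orth_sum (s t : sform) : sform :=
  let A := sobj s in let B := sobj t in
  @SForm (bip A B) (dualm (pr1 A B) \oc smap s \oc pr1 A B
                    + dualm (pr2 A B) \oc smap t \oc pr2 A B).

Definition zero_form : sform := @SForm zobj 0.

(* The matrix [0, id; eps omega, 0] : Q (+) Q^* -> Q^* (+) Q^**, under the same
   identification of the target with (Q (+) Q^* )^*. *)
Definition hyp_form (eps : int) (Q : C) : sform :=
  let P1 := pr1 Q (dual Q) in let P2 := pr2 Q (dual Q) in
  @SForm (bip Q (dual Q))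
    (dualm P1 \oc P2 + (dualm P2 \oc omega Q \oc P1) *~ eps).

Definition hyperbolic (eps : int) (s : sform) :=
  exists2 Q : C, reflexive_obj Q & isometric s (hyp_form eps Q).

Lemma hyp_form_hermitian eps Q :
  eps = 1 \/ eps = -1 -> eps_hermitian eps (hyp_form eps Q).
Proof.
move=> heps; have ee : eps * eps = 1 by case: heps => ->.
rewrite /eps_hermitian /adjoint /= dualmD dualmMz !dualmM compDl compMzl.
rewrite -!compA -!omega_nat [dualm (omega Q) \oc _]compA omega_dual comp1m.
by rewrite mulrzDl -mulrzA ee mulr1z addrC.
Qed.

Lemma is_isoMz eps A B (f : hom A B) :
  eps = 1 \/ eps = -1 -> is_iso f -> is_iso (f *~ eps).
Proof.
move=> heps [g [gf fg]]; have ee : eps * eps = 1 by case: heps => ->.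
by exists (g *~ eps); rewrite !compMzl !compMzr -!mulrzA ee !mulr1z.
Qed.

Lemma hyp_form_unimodular eps Q :
  eps = 1 \/ eps = -1 -> reflexive_obj Q -> unimodular (hyp_form eps Q).
Proof.
move=> heps [w [wo ow]]; have ee : eps * eps = 1 by case: heps => ->.
have hi : is_iso (smap (hyp_form eps Q)).
  pose Q' := dual Q.
  exists (in2 Q Q' \oc dualm (in1 Q Q')
          + (in1 Q Q' \oc w \oc dualm (in2 Q Q')) *~ eps).
  have e11 : dualm (in1 Q Q') \oc dualm (pr1 Q Q') = idm _.
    by rewrite -dualmM pr1_in1 dualm1.
  have e22 : dualm (in2 Q Q') \oc dualm (pr2 Q Q') = idm _.
    by rewrite -dualmM pr2_in2 dualm1.
  have e12 : dualm (in1 Q Q') \oc dualm (pr2 Q Q') = 0.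
    by rewrite -dualmM pr2_in1 dualm0.
  have e21 : dualm (in2 Q Q') \oc dualm (pr1 Q Q') = 0.
    by rewrite -dualmM pr1_in2 dualm0.
  split; rewrite /= -/Q' !(compDl, compDr, compMzl, compMzr) !compA.
    rewrite -(compA _ (dualm (in1 Q Q'))) e11 -(compA _ (dualm (in2 Q Q'))) e21.
    rewrite -(compA _ (dualm (in1 Q Q'))) e12 -(compA _ (dualm (in2 Q Q'))) e22.
    rewrite !compm1 !compm0 !comp0m !mul0rz addr0 add0r -(compA _ w) wo compm1.
    by rewrite -mulrzA ee mulr1z addrC bip_id.
  rewrite -(compA _ (pr2 Q Q')) pr2_in2 -(compA _ (pr1 Q Q')) pr1_in2.
  rewrite -(compA _ (pr2 Q Q')) pr2_in1 -(compA _ (pr1 Q Q')) pr1_in1.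
  rewrite !compm1 !compm0 !comp0m !mul0rz addr0 add0r -(compA _ _ w) ow compm1.
  by rewrite -mulrzA ee mulr1z -!dualmM -dualmD bip_id dualm1.
split=> //.
have -> : adjoint (hyp_form eps Q) = smap (hyp_form eps Q) *~ eps.
  by rewrite (hyp_form_hermitian Q heps) -mulrzA ee mulr1z.
exact: is_isoMz.
Qed.

Lemma isometric_refl s : isometric s s.
Proof.
exists (idm _); split; first exact: is_iso_id.
by rewrite dualm1 comp1m compm1.
Qed.

Lemma isometric_sym s t : isometric s t -> isometric t s.
Proof.
move=> [f [[g [gf fg]] e]]; exists g; split; first by exists f.
by rewrite e !compA -dualmM fg dualm1 comp1m -compA fg compm1.
Qed.

Lemma isometric_trans s t u : isometric s t -> isometric t u -> isometric s u.
Proof.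
move=> [f [fi e]] [g [gi e']]; exists (g \oc f); split.
  exact: is_iso_comp.
by rewrite e e' dualmM !compA.
Qed.

Lemma orth_sum_pull s t D (f : hom D (bip (sobj s) (sobj t))) :
  dualm f \oc smap (orth_sum s t) \oc f =
  dualm (pr1 _ _ \oc f) \oc smap s \oc (pr1 _ _ \oc f)
  + dualm (pr2 _ _ \oc f) \oc smap t \oc (pr2 _ _ \oc f).
Proof. by rewrite /= compDr compDl !dualmM !compA. Qed.

Lemma adjoint_orth_sum s t :
  adjoint (orth_sum s t) =
  smap (orth_sum (SForm (adjoint s)) (SForm (adjoint t))).
Proof.
rewrite /adjoint /= dualmD compDl !dualmM.
by congr (_ + _); rewrite -!compA -omega_nat !compA.
Qed.

Lemma orth_sum_iso s t :
  is_iso (smap s) -> is_iso (smap t) -> is_iso (smap (orth_sum s t)).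
Proof.
case: s t => [A s] [B t] /= [s' [s's ss']] [t' [t't tt']].
exists (in1 A B \oc s' \oc dualm (in1 A B) + in2 A B \oc t' \oc dualm (in2 A B)).
have e11 : dualm (in1 A B) \oc dualm (pr1 A B) = idm _.
  by rewrite -dualmM pr1_in1 dualm1.
have e22 : dualm (in2 A B) \oc dualm (pr2 A B) = idm _.
  by rewrite -dualmM pr2_in2 dualm1.
have e12 : dualm (in1 A B) \oc dualm (pr2 A B) = 0.
  by rewrite -dualmM pr2_in1 dualm0.
have e21 : dualm (in2 A B) \oc dualm (pr1 A B) = 0.
  by rewrite -dualmM pr1_in2 dualm0.
split.
  rewrite compDr !compDl !compA.
  rewrite -(compA _ (dualm (in1 A B))) e11 -(compA _ (dualm (in2 A B))) e21.
  rewrite -(compA _ (dualm (in1 A B))) e12 -(compA _ (dualm (in2 A B))) e22.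
  rewrite !compm1 !compm0 !comp0m addr0 add0r.
  by rewrite -(compA _ s') s's -(compA _ t') t't !compm1 bip_id.
rewrite compDr !compDl !compA.
rewrite -(compA _ (pr1 A B)) pr1_in1 -(compA _ (pr2 A B)) pr2_in1.
rewrite -(compA _ (pr1 A B)) pr1_in2 -(compA _ (pr2 A B)) pr2_in2.
rewrite !compm1 !compm0 !comp0m addr0 add0r.
rewrite -(compA _ s) ss' -(compA _ t) tt' !compm1.
by rewrite -!dualmM -dualmD bip_id dualm1.
Qed.

Lemma orth_sum_unimodular s t :
  unimodular s -> unimodular t -> unimodular (orth_sum s t).
Proof.
move=> [hs hs'] [ht ht']; split; first exact: orth_sum_iso.
by rewrite adjoint_orth_sum; apply: (orth_sum_iso (s := SForm (adjoint s)) (t := SForm (adjoint t))).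
Qed.

Lemma orth_sum_hermitian eps s t :
  eps_hermitian eps s -> eps_hermitian eps t ->
  eps_hermitian eps (orth_sum s t).
Proof.
move=> hs ht; rewrite /eps_hermitian adjoint_orth_sum /= {1}hs {1}ht.
by rewrite !compMzr !compMzl mulrzDl.
Qed.

Lemma zero_form_unimodular : unimodular zero_form.
Proof.
have e : idm (dual (zobj : C)) = 0 by rewrite -dualm1 idm_zobj dualm0.
have z : is_iso (0 : hom zobj (dual (zobj : C))).
  by exists 0; rewrite !compm0 idm_zobj e.
by split; rewrite // /adjoint /= dualm0 comp0m.
Qed.

Lemma zero_form_hermitian eps : eps_hermitian eps zero_form.
Proof. by rewrite /eps_hermitian /adjoint /= dualm0 comp0m mul0rz. Qed.

Lemma orth_sum_isometric s s' t t' :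
  isometric s s' -> isometric t t' ->
  isometric (orth_sum s t) (orth_sum s' t').
Proof.
move=> [f [[f' [f'f ff']] ef]] [g [[g' [g'g gg']] eg]].
exists (pair_m (f \oc pr1 _ _) (g \oc pr2 _ _)); split.
  exists (pair_m (f' \oc pr1 _ _) (g' \oc pr2 _ _)); split; apply: bip_ext.
  - by rewrite compA pr1_pair -compA pr1_pair compA f'f comp1m compm1.
  - by rewrite compA pr2_pair -compA pr2_pair compA g'g comp1m compm1.
  - by rewrite compA pr1_pair -compA pr1_pair compA ff' comp1m compm1.
  - by rewrite compA pr2_pair -compA pr2_pair compA gg' comp1m compm1.
by rewrite orth_sum_pull pr1_pair pr2_pair /= ef eg !dualmM !compA.
Qed.

Lemma orth_sumC s t : isometric (orth_sum s t) (orth_sum t s).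
Proof.
exists (pair_m (pr2 _ _) (pr1 _ _)); split.
  exists (pair_m (pr2 _ _) (pr1 _ _)).
  by split; apply: bip_ext;
    rewrite compA ?pr1_pair ?pr2_pair ?pr1_pair compm1.
by rewrite orth_sum_pull pr1_pair pr2_pair addrC.
Qed.

Lemma orth_sum0 s : isometric (orth_sum zero_form s) s.
Proof.
exists (pr2 _ _); split.
  exists (in2 _ _); split; last exact: pr2_in2.
  apply: bip_ext.
    rewrite -[LHS]comp1m idm_zobj comp0m.
    by rewrite compm1 -[RHS]comp1m idm_zobj comp0m.
  by rewrite compA pr2_in2 comp1m compm1.
by rewrite /= compm0 comp0m add0r.
Qed.

Lemma orth_sumA s t u :
  isometric (orth_sum s (orth_sum t u)) (orth_sum (orth_sum s t) u).
Proof.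
pose A := sobj s; pose B := sobj t; pose D := sobj u.
pose q1 := pr1 A (bip B D); pose q2 := pr1 B D \oc pr2 A (bip B D).
pose q3 := pr2 B D \oc pr2 A (bip B D).
pose r1 := pr1 A B \oc pr1 (bip A B) D; pose r2 := pr2 A B \oc pr1 (bip A B) D.
pose r3 := pr2 (bip A B) D.
exists (pair_m (pair_m q1 q2) q3); split.
  exists (pair_m r1 (pair_m r2 r3)); split.
    apply: bip_ext; first by rewrite compA pr1_pair -compA !pr1_pair compm1.
    rewrite compA pr2_pair; apply: bip_ext.
      by rewrite compA pr1_pair -compA pr1_pair pr2_pair compm1.
    by rewrite compA !pr2_pair compm1.
  apply: bip_ext; last by rewrite compA pr2_pair -compA !pr2_pair compm1.
  rewrite compA pr1_pair; apply: bip_ext.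
    by rewrite compA !pr1_pair compm1.
  by rewrite compA pr2_pair -compA pr2_pair pr1_pair compm1.
rewrite orth_sum_pull pr1_pair pr2_pair orth_sum_pull pr1_pair pr2_pair.
by rewrite /= !compDr !compDl !dualmM !compA addrA.
Qed.

End Forms.

Section IsometryClasses.
Variables (C : hermCat) (eps : int).

Record hform := HForm {
  hf_form :> sform C;
  hf_unimodular : unimodular hf_form;
  hf_hermitian : eps_hermitian eps hf_form }.

Definition hf_isometry := @PropEquiv hform
  (fun s t => isometric s t) (fun s => @isometric_refl C s)
  (fun s t => @isometric_sym C s t) (fun s t u => @isometric_trans C s t u).

Definition hf_sum (s t : hform) : hform :=
  HForm (orth_sum_unimodular (hf_unimodular s) (hf_unimodular t))
        (orth_sum_hermitian (hf_hermitian s) (hf_hermitian t)).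

Definition hf_zero : hform :=
  HForm (zero_form_unimodular C) (zero_form_hermitian C eps).

Definition iso_classes : Type := cquot hf_isometry.
HB.instance Definition _ := Choice.on iso_classes.

Definition iso_class (s : hform) : iso_classes := cls hf_isometry s.

Lemma iso_class_surj x : exists s, x = iso_class s.
Proof. exact: cls_surj. Qed.

Lemma iso_classP s t : iso_class s = iso_class t <-> isometric s t.
Proof. exact: (@clsP _ hf_isometry). Qed.

Definition iso_classes_add (x y : iso_classes) : iso_classes :=
  iso_class (hf_sum (rep x) (rep y)).

Lemma iso_classes_addE s t :
  iso_classes_add (iso_class s) (iso_class t) = iso_class (hf_sum s t).
Proof. by apply/iso_classP/orth_sum_isometric; apply: (@rep_cls _ hf_isometry). Qed.

Let addA : associative iso_classes_add.
Proof.
move=> x y z; have [s ->] := iso_class_surj x; have [t ->] := iso_class_surj y.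
have [u ->] := iso_class_surj z.
by rewrite !iso_classes_addE; apply/iso_classP/orth_sumA.
Qed.

Let addC : commutative iso_classes_add.
Proof.
move=> x y; have [s ->] := iso_class_surj x; have [t ->] := iso_class_surj y.
by rewrite !iso_classes_addE; apply/iso_classP/orth_sumC.
Qed.

Let add0 : left_id (iso_class hf_zero) iso_classes_add.
Proof. by move=> x; have [s ->] := iso_class_surj x; rewrite iso_classes_addE; apply/iso_classP/orth_sum0. Qed.

HB.instance Definition _ := GRing.isNmodule.Build iso_classes addA addC add0.

Lemma iso_classD s t : iso_class (hf_sum s t) = iso_class s + iso_class t.
Proof. by rewrite -iso_classes_addE. Qed.

End IsometryClasses.

Section Grothendieck.
Variable M : nmodType.

Definition groth_rel (p q : M * M) := exists k, p.1 + q.2 + k = q.1 + p.2 + k.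

Lemma groth_refl p : groth_rel p p. Proof. by exists 0. Qed.

Lemma groth_sym p q : groth_rel p q -> groth_rel q p.
Proof. by move=> [k e]; exists k. Qed.

Lemma groth_trans p q r : groth_rel p q -> groth_rel q r -> groth_rel p r.
Proof.
move=> [k e] [l e']; exists (q.2 + k + (q.1 + l)).
rewrite [LHS](AC (2*(2*2)) ((1*3*4)*(5*2*6))).
by rewrite [RHS](AC (2*(2*2)) ((5*2*4)*(1*3*6))) /= e e'.
Qed.

Definition groth_equiv := PropEquiv groth_refl groth_sym groth_trans.

Definition groth : Type := cquot groth_equiv.
HB.instance Definition _ := Choice.on groth.

(* The formal difference a - b. *)
Definition gdiff (a b : M) : groth := cls groth_equiv (a, b).
Definition grep (x : groth) : M * M := rep x.

Lemma gdiffP a b a' b' :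
  gdiff a b = gdiff a' b' <-> exists k, a + b' + k = a' + b + k.
Proof. exact: (@clsP _ groth_equiv). Qed.

Lemma gdiff_surj x : exists a b, x = gdiff a b.
Proof. by have [[a b] ->] := cls_surj x; exists a, b. Qed.

Lemma grepK x : gdiff (grep x).1 (grep x).2 = x.
Proof. by rewrite /gdiff -surjective_pairing repK. Qed.

Definition groth_add (x y : groth) : groth :=
  gdiff ((grep x).1 + (grep y).1) ((grep x).2 + (grep y).2).
Definition groth_opp (x : groth) : groth := gdiff (grep x).2 (grep x).1.

Let addE a b a' b' :
  groth_add (gdiff a b) (gdiff a' b') = gdiff (a + a') (b + b').
Proof.
have /gdiffP[k e] := grepK (gdiff a b).
have /gdiffP[l e'] := grepK (gdiff a' b').
apply/gdiffP; exists (k + l).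
rewrite [LHS](AC ((2*2)*2) ((1*3*5)*(2*4*6))) /=.
by rewrite [RHS](AC ((2*2)*2) ((1*3*5)*(2*4*6))) /= e e'.
Qed.

Let oppE a b : groth_opp (gdiff a b) = gdiff b a.
Proof.
have /gdiffP[k e] := grepK (gdiff a b).
by apply/gdiffP; exists k; rewrite [_ + a]addrC -e [_ + b]addrC.
Qed.

Let addA : associative groth_add.
Proof.
move=> x y z; have [a [b ->]] := gdiff_surj x; have [a' [b' ->]] := gdiff_surj y.
by have [a'' [b'' ->]] := gdiff_surj z; rewrite !addE !addrA.
Qed.

Let addC : commutative groth_add.
Proof.
move=> x y; have [a [b ->]] := gdiff_surj x; have [a' [b' ->]] := gdiff_surj y.
by rewrite !addE [a + _]addrC [b + _]addrC.
Qed.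

Let add0 : left_id (gdiff 0 0) groth_add.
Proof. by move=> x; have [a [b ->]] := gdiff_surj x; rewrite addE !add0r. Qed.

Let addN : left_inverse (gdiff 0 0) groth_opp groth_add.
Proof.
move=> x; have [a [b ->]] := gdiff_surj x; rewrite oppE addE.
by apply/gdiffP; exists 0; rewrite !addr0 !add0r addrC.
Qed.

HB.instance Definition _ := GRing.isZmodule.Build groth addA addC add0 addN.

Lemma gdiffD a b a' b' : gdiff a b + gdiff a' b' = gdiff (a + a') (b + b').
Proof. exact: addE. Qed.

Lemma gdiffN a b : - gdiff a b = gdiff b a.
Proof. exact: oppE. Qed.

Definition groth_in (a : M) : groth := gdiff a 0.

Lemma gdiffE a b : gdiff a b = groth_in a - groth_in b.
Proof. by rewrite gdiffN gdiffD addr0 add0r. Qed.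

Lemma groth_inD a b : groth_in (a + b) = groth_in a + groth_in b.
Proof. by rewrite gdiffD addr0. Qed.

End Grothendieck.

Section GrothendieckMap.
Variables (M N : nmodType) (f : {additive M -> N}).

Definition groth_map (x : groth M) : groth N := gdiff (f (grep x).1) (f (grep x).2).

Lemma groth_mapE a b : groth_map (gdiff a b) = gdiff (f a) (f b).
Proof.
have /gdiffP[k e] := grepK (gdiff a b).
by apply/gdiffP; exists (f k); rewrite -!raddfD e.
Qed.

Lemma groth_map_in a : groth_map (groth_in a) = groth_in (f a).
Proof. by rewrite groth_mapE raddf0. Qed.

Lemma groth_map_is_additive : zmod_morphism groth_map.
Proof.
move=> x y; have [a [b ->]] := gdiff_surj x; have [a' [b' ->]] := gdiff_surj y.
by rewrite gdiffN gdiffD !groth_mapE gdiffN gdiffD !raddfD.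
Qed.

HB.instance Definition _ :=
  GRing.isZmodMorphism.Build (groth M) (groth N) groth_map groth_map_is_additive.

End GrothendieckMap.

Section Witt.
Variables (C : hermCat) (eps : int).

Definition hyp_span : {pred groth (iso_classes C eps)} := fun x =>
  `[< forall S : {pred groth (iso_classes C eps)}, zmod_closed S ->
      (forall s : hform C eps, hyperbolic eps s ->
         groth_in (iso_class s) \in S) ->
      x \in S >].

Lemma hyp_spanP x :
  reflect (forall S : {pred groth (iso_classes C eps)}, zmod_closed S ->
             (forall s : hform C eps, hyperbolic eps s ->
                groth_in (iso_class s) \in S) ->
             x \in S) (x \in hyp_span).
Proof. exact: asboolP. Qed.

Lemma hyp_span_zmod : zmod_closed hyp_span.
Proof.
split=> [|x y /hyp_spanP hx /hyp_spanP hy]; apply/hyp_spanP=> S Sz Sh.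
  by case: Sz.
by case: (Sz) => _; apply; [apply: hx | apply: hy].
Qed.

HB.instance Definition _ := GRing.isZmodClosed.Build _ hyp_span hyp_span_zmod.

Lemma hyp_span_hyp (s : hform C eps) :
  hyperbolic eps s -> groth_in (iso_class s) \in hyp_span.
Proof. by move=> hs; apply/hyp_spanP=> S _; apply. Qed.

Definition hyp_subgroup : zmodClosed (groth (iso_classes C eps)) :=
  GRing.ZmodClosed.clone _ hyp_span _.

Definition witt : Type := Quotient.quot hyp_subgroup.
HB.instance Definition _ := GRing.Zmodule.on witt.

Definition witt_of (x : groth (iso_classes C eps)) : witt := \pi_((Quotient.quot hyp_subgroup)) x.
Definition witt_rep (x : witt) : groth (iso_classes C eps) :=
  repr (x : (Quotient.quot hyp_subgroup)).

Lemma witt_ofP x y : witt_of x = witt_of y <-> x - y \in hyp_span.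
Proof.
rewrite Quotient.idealrBE; split=> [h|/eqP //]; exact/eqP.
Qed.

Lemma witt_repK x : witt_of (witt_rep x) = x. Proof. exact: reprK. Qed.

Lemma witt_of_is_additive : zmod_morphism witt_of.
Proof. exact: (raddfB \pi_((Quotient.quot hyp_subgroup))). Qed.

HB.instance Definition _ :=
  GRing.isZmodMorphism.Build _ witt witt_of witt_of_is_additive.

Definition witt_class (s : hform C eps) : witt := witt_of (groth_in (iso_class s)).

End Witt.

Arguments hyp_span : clear implicits.
Arguments hyp_subgroup : clear implicits.

Section ScalarExtension.
Variables (K : fieldType) (L : fieldExtType K) (C : linHermCat K).
Implicit Types A B D : C.

Definition ext_hom A B : zmodType := tensor (lhom A B) L.

Definition ext_tens A B (f : hom A B) (a : L) : ext_hom A B :=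
  tens (f : lhom A B) a.

Definition ext_comp A B D (y : ext_hom B D) (x : ext_hom A B) : ext_hom A D :=
  tens_lift (fun (g : lhom B D) (b : L) =>
    tens_lift (fun (f : lhom A B) (a : L) => ext_tens (g \oc f) (b * a)) x) y.

Definition ext_dualm A B (x : ext_hom A B) : ext_hom (dual B) (dual A) :=
  tens_lift (fun (f : lhom A B) (a : L) => ext_tens (dualm f) a) x.

Lemma ext_tensDl A B (f f' : hom A B) a :
  ext_tens (f + f') a = ext_tens f a + ext_tens f' a.
Proof. exact: tensDl. Qed.

Lemma ext_tensDr A B (f : hom A B) a a' :
  ext_tens f (a + a') = ext_tens f a + ext_tens f a'.
Proof. exact: tensDr. Qed.

Lemma ext_tensZ A B c (f : hom A B) a :
  ext_tens (hscale c f) a = ext_tens f (c *: a).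
Proof. exact: tensZ. Qed.

Lemma ext_tens0 A B a : ext_tens (0 : hom A B) a = 0.
Proof. by apply: (addrI (ext_tens 0 a)); rewrite -ext_tensDl !addr0. Qed.

Lemma ext_tensMz A B (f : hom A B) a n :
  ext_tens (f *~ n) a = ext_tens f a *~ n.
Proof. exact: (morphMz (fun f f' => ext_tensDl f f' a)). Qed.

Lemma ext_ind A B (P : ext_hom A B -> Prop) :
  P 0 -> (forall x y, P x -> P y -> P (x + y)) ->
  (forall f a, P (ext_tens f a)) -> forall x, P x.
Proof. exact: tens_ind. Qed.

Let balanced_in A B D (g : hom B D) b :
  balanced (fun (f : lhom A B) (a : L) => ext_tens (g \oc f) (b * a)).
Proof.
split=> [f f' a|f a a'|c f a].
- by rewrite compDr ext_tensDl.
- by rewrite mulrDr ext_tensDr.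
- by rewrite [g \oc _]comp_scaler ext_tensZ scalerAr.
Qed.

Let balanced_out A B D (x : ext_hom A B) :
  balanced (fun (g : lhom B D) (b : L) =>
              tens_lift (fun (f : lhom A B) (a : L) => ext_tens (g \oc f) (b * a)) x).
Proof.
split=> [g g' b|g b b'|c g b]; rewrite -?tens_lift_add;
  apply: eq_tens_lift=> f a.
- by rewrite compDl ext_tensDl.
- by rewrite mulrDl ext_tensDr.
- by rewrite comp_scalel ext_tensZ scalerAl.
Qed.

Let balanced_dual A B :
  balanced (fun (f : lhom A B) (a : L) => ext_tens (dualm f) a).
Proof.
split=> [f f' a|f a a'|c f a].
- by rewrite dualmD ext_tensDl.
- by rewrite ext_tensDr.
- by rewrite [dualm _]dualm_scale ext_tensZ.
Qed.

Lemma ext_comp_tens A B D (g : hom B D) b (f : hom A B) a :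
  ext_comp (ext_tens g b) (ext_tens f a) = ext_tens (g \oc f) (b * a).
Proof.
by rewrite /ext_comp (tens_liftE (balanced_out _ _)) (tens_liftE (balanced_in _ _ _)).
Qed.

Lemma ext_compDl A B D (y y' : ext_hom B D) (x : ext_hom A B) :
  ext_comp (y + y') x = ext_comp y x + ext_comp y' x.
Proof. exact: (tens_liftD (balanced_out _ _)). Qed.

Lemma ext_compDr A B D (y : ext_hom B D) (x x' : ext_hom A B) :
  ext_comp y (x + x') = ext_comp y x + ext_comp y x'.
Proof.
rewrite /ext_comp -tens_lift_add; apply: eq_tens_lift=> g b.
exact: (tens_liftD (balanced_in _ _ _)).
Qed.

Lemma ext_comp0l A B D (x : ext_hom A B) : ext_comp (0 : ext_hom B D) x = 0.
Proof. by apply: (addrI (ext_comp 0 x)); rewrite -ext_compDl !addr0. Qed.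

Lemma ext_comp0r A B D (y : ext_hom B D) : ext_comp y (0 : ext_hom A B) = 0.
Proof. by apply: (addrI (ext_comp y 0)); rewrite -ext_compDr !addr0. Qed.

Lemma ext_compA A B D E (z : ext_hom D E) (y : ext_hom B D) (x : ext_hom A B) :
  ext_comp z (ext_comp y x) = ext_comp (ext_comp z y) x.
Proof.
elim/ext_ind: z => [|z z' ih ih'|h c]; first by rewrite !ext_comp0l.
  by rewrite !ext_compDl ih ih'.
elim/ext_ind: y => [|y y' ih ih'|g b].
- by rewrite !(ext_comp0l, ext_comp0r).
- by rewrite !(ext_compDl, ext_compDr) ih ih'.
elim/ext_ind: x => [|x x' ih ih'|f a]; first by rewrite !ext_comp0r.
  by rewrite !ext_compDr ih ih'.
by rewrite !ext_comp_tens compA mulrA.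
Qed.

Lemma ext_comp1l A B (x : ext_hom A B) : ext_comp (ext_tens (idm B) 1) x = x.
Proof.
elim/ext_ind: x => [|x x' ih ih'|f a]; first by rewrite ext_comp0r.
  by rewrite ext_compDr ih ih'.
by rewrite ext_comp_tens comp1m mul1r.
Qed.

Lemma ext_comp1r A B (x : ext_hom A B) : ext_comp x (ext_tens (idm A) 1) = x.
Proof.
elim/ext_ind: x => [|x x' ih ih'|f a]; first by rewrite ext_comp0l.
  by rewrite ext_compDl ih ih'.
by rewrite ext_comp_tens compm1 mulr1.
Qed.

Definition ext_addCat : addCat.
Proof.
refine (@AddCat C ext_hom (fun A => ext_tens (idm A) 1) ext_comp
  ext_compA ext_comp1l ext_comp1r ext_compDl ext_compDr zobj _ (@bip C)
  (fun A B => ext_tens (in1 A B) 1) (fun A B => ext_tens (in2 A B) 1)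
  (fun A B => ext_tens (pr1 A B) 1) (fun A B => ext_tens (pr2 A B) 1)
  _ _ _ _ _) => [|A B|A B|A B|A B|A B].
- by rewrite idm_zobj ext_tens0.
- by rewrite ext_comp_tens pr1_in1 mulr1.
- by rewrite ext_comp_tens pr2_in2 mulr1.
- by rewrite ext_comp_tens pr1_in2 ext_tens0.
- by rewrite ext_comp_tens pr2_in1 ext_tens0.
- by rewrite !ext_comp_tens !mulr1 -ext_tensDl bip_id.
Defined.

Lemma ext_dualm_tens A B (f : hom A B) a :
  ext_dualm (ext_tens f a) = ext_tens (dualm f) a.
Proof. exact: (tens_liftE (@balanced_dual A B)). Qed.

Lemma ext_dualmD A B (x y : ext_hom A B) :
  ext_dualm (x + y) = ext_dualm x + ext_dualm y.
Proof. exact: (tens_liftD (@balanced_dual A B)). Qed.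

Lemma ext_dualm0 A B : ext_dualm (0 : ext_hom A B) = 0.
Proof. by apply: (addrI (ext_dualm 0)); rewrite -ext_dualmD !addr0. Qed.

Lemma ext_dualmM A B D (y : ext_hom B D) (x : ext_hom A B) :
  ext_dualm (ext_comp y x) = ext_comp (ext_dualm x) (ext_dualm y).
Proof.
elim/ext_ind: y => [|y y' ih ih'|g b].
- by rewrite !(ext_comp0l, ext_dualm0, ext_comp0r).
- by rewrite !(ext_compDl, ext_dualmD, ext_compDr) ih ih'.
elim/ext_ind: x => [|x x' ih ih'|f a].
- by rewrite !(ext_comp0l, ext_dualm0, ext_comp0r).
- by rewrite !(ext_compDl, ext_dualmD, ext_compDr) ih ih'.
by rewrite !(ext_comp_tens, ext_dualm_tens) dualmM mulrC.
Qed.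

Lemma ext_omega_nat A B (x : ext_hom A B) :
  ext_comp (ext_tens (omega B) 1) x =
  ext_comp (ext_dualm (ext_dualm x)) (ext_tens (omega A) 1).
Proof.
elim/ext_ind: x => [|x x' ih ih'|f a].
- by rewrite !(ext_comp0l, ext_dualm0, ext_comp0r).
- by rewrite !(ext_compDl, ext_dualmD, ext_compDr) ih ih'.
by rewrite !(ext_comp_tens, ext_dualm_tens) omega_nat mul1r mulr1.
Qed.

(* The formal symbol C_L is represented by the object C itself. *)
Definition scalar_ext : hermCat.
Proof.
refine (@HermCat ext_addCat (@dual C) ext_dualm _ ext_dualmM ext_dualmD
  (fun A => ext_tens (omega A) 1) ext_omega_nat _) => A /=.
- by rewrite ext_dualm_tens dualm1.
- by rewrite ext_dualm_tens ext_comp_tens omega_dual mulr1.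
Defined.

Definition ext_form (s : sform C) : sform scalar_ext :=
  @SForm scalar_ext (sobj s) (ext_tens (smap s) 1).

Lemma ext_is_iso A B (f : hom A B) :
  is_iso f -> @is_iso scalar_ext A B (ext_tens f 1).
Proof.
move=> [g [gf fg]]; exists (ext_tens g 1).
by rewrite /= !ext_comp_tens gf fg !mulr1.
Qed.

Lemma ext_adjoint s : adjoint (ext_form s) = ext_tens (adjoint s) 1.
Proof. by rewrite /adjoint /= ext_dualm_tens ext_comp_tens mulr1. Qed.

Lemma ext_unimodular s : unimodular s -> unimodular (ext_form s).
Proof.
by move=> [h h']; split; [|rewrite ext_adjoint]; apply: ext_is_iso.
Qed.

Lemma ext_hermitian eps s : eps_hermitian eps s -> eps_hermitian eps (ext_form s).
Proof. by rewrite /eps_hermitian ext_adjoint /= => {1}->; rewrite ext_tensMz. Qed.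

Lemma ext_isometric s t : isometric s t -> isometric (ext_form s) (ext_form t).
Proof.
move=> [f [fi e]]; exists (ext_tens f 1); split; first exact: ext_is_iso.
by rewrite /= ext_dualm_tens !ext_comp_tens !mulr1 e.
Qed.

Lemma ext_orth_sum s t :
  ext_form (orth_sum s t) = orth_sum (ext_form s) (ext_form t).
Proof.
rewrite /ext_form /orth_sum /=; congr (@SForm scalar_ext _ _).
by rewrite !ext_dualm_tens !ext_comp_tens !mulr1 ext_tensDl.
Qed.

Lemma ext_zero_form : ext_form (zero_form C) = zero_form scalar_ext.
Proof. by congr (@SForm scalar_ext _ _); apply: ext_tens0. Qed.

Lemma ext_hyp_form eps Q : ext_form (hyp_form eps Q) = @hyp_form scalar_ext eps Q.
Proof.
rewrite /ext_form /hyp_form /=; congr (@SForm scalar_ext _ _).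
by rewrite !ext_dualm_tens !ext_comp_tens !mulr1 ext_tensDl ext_tensMz.
Qed.

Lemma ext_hyperbolic eps s : hyperbolic eps s -> hyperbolic eps (ext_form s).
Proof.
move=> [Q Qr h]; exists (Q : scalar_ext); first exact: ext_is_iso.
by rewrite -ext_hyp_form; apply: ext_isometric.
Qed.

Variable eps : int.

Definition ext_hform (s : hform C eps) : hform scalar_ext eps :=
  HForm (ext_unimodular (hf_unimodular s)) (ext_hermitian (hf_hermitian s)).

Definition iso_ext (x : iso_classes C eps) : iso_classes scalar_ext eps :=
  iso_class (ext_hform (rep x)).

Lemma iso_extE s : iso_ext (iso_class s) = iso_class (ext_hform s).
Proof. exact/iso_classP/ext_isometric/(@rep_cls _ (hf_isometry C eps)). Qed.

Lemma iso_ext_is_nmod_morphism : nmod_morphism iso_ext.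
Proof.
split.
  rewrite (iso_extE (hf_zero C eps)); apply/iso_classP.
  by rewrite /= ext_zero_form; apply: isometric_refl.
move=> x y; have [s ->] := iso_class_surj x; have [t ->] := iso_class_surj y.
rewrite -iso_classD !iso_extE -iso_classD; apply/iso_classP.
by rewrite /= ext_orth_sum; apply: isometric_refl.
Qed.

HB.instance Definition _ :=
  GRing.isNmodMorphism.Build _ _ iso_ext iso_ext_is_nmod_morphism.

Lemma groth_ext_hyp_span x :
  x \in hyp_span C eps -> groth_map iso_ext x \in hyp_span scalar_ext eps.
Proof.
move=> /hyp_spanP /(_ [pred x | groth_map iso_ext x \in hyp_span scalar_ext eps]).
apply=> [|s hs]; last first.
  rewrite inE groth_map_in /= iso_extE.
  exact/hyp_span_hyp/ext_hyperbolic.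
split=> [|y z]; rewrite !inE ?raddf0 ?rpred0 // => hy hz.
by rewrite raddfB rpredB.
Qed.

(* The map W^eps(C) -> W^eps(C_L) induced by (M, s) |-> (M_L, s_L); see
   [witt_ext_class]. *)
Definition witt_ext (x : witt C eps) : witt scalar_ext eps :=
  witt_of (groth_map iso_ext (witt_rep x)).

Lemma witt_ext_of x : witt_ext (witt_of x) = witt_of (groth_map iso_ext x).
Proof.
apply/witt_ofP; rewrite -raddfB; apply/groth_ext_hyp_span/witt_ofP.
exact: witt_repK.
Qed.

Lemma witt_ext_class s : witt_ext (witt_class s) = witt_class (ext_hform s).
Proof. by rewrite witt_ext_of groth_map_in /= iso_extE. Qed.

Lemma witt_ext_is_additive : zmod_morphism witt_ext.
Proof.
by move=> x y; rewrite -[x]witt_repK -[y]witt_repK -raddfB !witt_ext_of !raddfB.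
Qed.

HB.instance Definition _ :=
  GRing.isZmodMorphism.Build _ _ witt_ext witt_ext_is_additive.

End ScalarExtension.

Arguments scalar_ext {K} L C.
Arguments witt_ext {K} L C eps.

(* Main.v *)
(* The proof is a transfer argument.  For L/K of odd degree n there is a
   K-subspace N of L of dimension (n - 1)/2 with 1 not in N + N N, built along a
   tower of simple extensions.  A K-linear s : L -> K with s(1) = 1 and vanishing
   on N + N N then makes (x, y) |-> s(x y) a form on L isometric to <1> plus
   hyperbolic planes.  Given an isometry f_L = g_L, applying s to its matrix in a
   suitable K-basis of L gives an isometry between the s-transfers of f_L and g_L,
   which are f and g plus hyperbolic forms; hence f = g in W(C).  An arbitrary
   element of the kernel of W(C) -> W(C_L) reduces to this case: s splits the
   extension of scalars, so an object reflexive over L is reflexive over K and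
   every hyperbolic form over C_L comes from C; and since 2 is invertible, a
   common summand k over C_L can be completed to the hyperbolic form k - k. *)

From HB Require Import structures.
From mathcomp Require Import all_boot all_order all_algebra all_field boolp.
Require Import Defs.

Set Implicit Arguments.
Unset Strict Implicit.
Unset Printing Implicit Defensive.

Import GRing.Theory.

Local Open Scope ring_scope.

(** * Lagrangian subspaces in extensions of odd degree *)

Section Lagrangian.
Variables (K : fieldType) (L : fieldExtType K).

(* If s : L -> K is linear with s(1) = 1 and s = 0 on N + N N, then N is a
   Lagrangian of the orthogonal of 1 in E for the form (x, y) |-> s(x y). *)
Definition lagrangian (E : {subfield L}) (N : {vspace L}) :=
  [/\ (N <= E)%VS, 1 \notin (N + N * N)%VS & (\dim N).*2.+1 = \dim E].

Lemma lagrangian_adjoin (E : {subfield L}) N a :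
  odd (\dim <<E; a>>) -> lagrangian E N ->
  exists N', lagrangian <<E; a>>%AS N'.
Proof.
move=> oddEa [sNE N1 dN].
have dEa := dim_Fadjoin E a; set n := adjoin_degree E a in dEa.
pose l := n./2.
have nl : n = l.*2.+1.
  have on : odd n by move: oddEa; rewrite dEa oddM => /andP[].
  by rewrite -[LHS]odd_double_half on.
(* With A the sum of the E a^i, 1 <= i <= l, the subspace N + A works: N A is in
   A, and A A is in the sum of the E a^i, 1 <= i <= 2 l < n. *)
pose U (i : 'I_n) := (E * <[a ^+ i]>)%VS.
pose V (i : 'I_n) := if i == 0 :> nat then N else U i.
have U0 (i : 'I_n) : i = 0 :> nat -> U i = E.
  by move=> i0; rewrite /U i0 expr0 prodv1.
have sVU i : (V i <= U i)%VS.
  by rewrite /V; case: eqP => // /U0 ->.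
have dxU : directv (\sum_i U i) := Fadjoin_sum_direct E a.
have DU : <<E; a>>%VS = (\sum_i U i)%VS := Fadjoin_eq_sum E a.
have a0 : (0 < l)%N -> a != 0.
  move=> l0; apply/eqP=> a0; have: n = 1 by rewrite /n a0 adjoin0_deg.
  by rewrite nl => -[/eqP]; rewrite double_eq0 => /eqP l0'; rewrite l0' in l0.
have dxV : directv (\sum_(i : 'I_n | (i <= l)%N) V i).
  apply/directv_sum_independent => us Vu us0 i il.
  pose vs (i : 'I_n) := if (i <= l)%N then us i else 0.
  have /directv_sum_independent/(_ vs) := dxU.
  have -> : us i = vs i by rewrite /vs il.
  apply=> // [j _|].
    rewrite /vs; case: ifP => [jl|_]; last exact: mem0v.
    exact/(subvP (sVU j))/Vu.
  by rewrite /vs -big_mkcond.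
have dimU (i : 'I_n) : (0 < l)%N -> \dim (U i) = \dim E.
  by move=> /a0 nza; rewrite dim_cosetv ?expf_neq0.
exists (\sum_(i : 'I_n | (i <= l)%N) V i)%VS; split.
- apply/subv_sumP=> i _; apply: subv_trans (sVU i) _.
  by rewrite /= DU (sumv_sup i).
- apply/negP=> mem1.
  have n0 : (0 < n)%N by rewrite nl.
  pose o : 'I_n := Ordinal n0.
  (* [B] is a complement of E = [U o] in E(a). The new subspace and its square lie in N + N N + [B],
     so their elements have E-component in N + N N. *)
  pose B := (\sum_(i : 'I_n | i != o) U i)%VS.
  have sVW : (\sum_(i : 'I_n | (i <= l)%N) V i <= N + N * N + B)%VS.
    apply/subv_sumP=> i _; rewrite /V; case: eqP => [_|i0].
      by rewrite -addvA addvSl.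
    apply: subv_trans (addvSr _ _); rewrite (sumv_sup i) //.
    by apply/eqP=> io; apply: i0; rewrite io.
  have sVVW : ((\sum_(i : 'I_n | (i <= l)%N) V i)
     * (\sum_(i : 'I_n | (i <= l)%N) V i) <= N + N * N + B)%VS.
    apply/prodvP=> _ _ /memv_sumP[u Vu ->] /memv_sumP[v Vv ->].
    rewrite mulr_suml memv_suml // => i il; rewrite mulr_sumr memv_suml // => j jl.
    have := Vu _ il; have := Vv _ jl.
    have ijn : (i + j < n)%N.
      by apply: (@leq_trans l.*2.+1); rewrite ?nl // ltnS -addnn leq_add.
    have [/eqP|ij0] := eqVneq (i + j)%N 0%N.
      rewrite addn_eq0 /V => /andP[-> ->] Nv Nu.
      apply: (subvP _ _ (memv_mul Nu Nv)).
      by rewrite -addvA (subv_trans _ (addvSr _ _)) ?addvSl.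
    move=> /(subvP (sVU _)) /memv_cosetP[y Ey ->].
    move=> /(subvP (sVU _)) /memv_cosetP[x Ex ->].
    rewrite mulrACA -exprD; apply: (subvP (addvSr _ _)).
    apply: (subvP (sumv_sup (Ordinal ijn) _ (subvv _))).
      by apply: contraNneq ij0 => /(congr1 (@nat_of_ord n)) /= ->.
    by rewrite memv_mul ?memv_line // memvM.
  have : 1 \in (N + N * N + B)%VS.
    by apply: subvP mem1; rewrite subv_add sVW sVVW.
  case/memv_addP=> w Ww [b /memv_sumP[c Uc Db] D1].
  case/negP: N1; suff -> : 1 = w by [].
  have Ew : w \in E.
    by apply: (subvP _ _ Ww); rewrite subv_add sNE prodv_sub.
  pose us i := if i == o then w - 1 else c i.
  have /directv_sum_independent/(_ us _ _ o isT) := dxU.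
  rewrite /us eqxx => e; apply/eqP; rewrite eq_sym -subr_eq0 e // => [i _|].
    case: eqP => [->|/eqP io]; last exact: Uc.
    by rewrite U0 // rpredB ?mem1v.
  rewrite (bigD1 o) //= (eq_bigr c) => [|i /negPf-> //].
  by rewrite -Db addrAC -D1 subrr.
(* The new subspace has dimension dim N + l dim E, and 2 (dim N + l dim E) + 1 = (2 l + 1) dim E = n
   dim E. *)
have ln : (l.+1 <= n)%N by rewrite nl ltnS -addnn leq_addr.
rewrite (directvP dxV) /= (big_ord_narrow ln) big_ord_recl /=.
rewrite (eq_bigr (fun=> \dim E)) => [|i _]; last first.
  by rewrite /V /= dimU // (leq_ltn_trans _ (ltn_ord i)).
rewrite sum_nat_const card_ord dEa.
by rewrite doubleD -addSn dN nl doubleMl mulSn.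
Qed.

(** Starting from E = K and N = 0, adjoin elements until E = L; each intermediate degree is odd
    because it divides that of L. *)
Lemma exists_lagrangian :
  odd (\dim {:L}) -> exists N, lagrangian {:L}%AS N.
Proof.
move=> oddL.
suff ext m (E : {subfield L}) N : (\dim {:L} - \dim E <= m)%N ->
    lagrangian E N -> exists N', lagrangian {:L}%AS N'.
  apply: (ext _ 1%AS 0%VS (leqnn _)); split; rewrite ?sub0v ?dimv0 ?dimv1 //.
  by rewrite prodv0 addv0 memv0 oner_eq0.
elim: m E N => [|m IHm] E N hm lagN.
  suff -> : {:L}%AS = E by exists N.
  apply/val_inj/eqP; rewrite /= eq_sym eqEdim subvf /=.
  by rewrite -subn_eq0 -leqn0.
have [sLE|/subvPn[a _ aE]] := boolP ({:L} <= E)%VS.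
  by apply: (IHm E N) lagN; rewrite (_ : _ - _ = 0)%N //; apply/eqP; rewrite subn_eq0 dimvS.
have odda : odd (\dim <<E; a>>).
  have /dvdnP[q e] := field_dimS (subvf <<E; a>>%AS).
  by move: oddL; rewrite e oddM => /andP[].
have [N' lagN'] := lagrangian_adjoin odda lagN.
apply: IHm lagN'; rewrite leq_subLR.
rewrite leq_subLR in hm; apply: leq_trans hm _; rewrite -addSnnS leq_add2r.
rewrite ltnNge; apply: contra aE => dle.
have /eqP -> : E == <<E; a>>%VS :> {vspace L} by rewrite eqEdim subv_adjoin.
exact: memv_adjoin.
Qed.

End Lagrangian.

(** * The form s(x y) on L and its hyperbolic basis *)

Section TraceForm.
Variables (K : fieldType) (L : fieldExtType K).

(** Take the coordinate on 1 of the projection to the line K 1 along W. *)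
Lemma scalar_extend1 (W : {vspace L}) :
  1 \notin W -> exists s : {scalar L}, s 1 = 1 /\ {in W, forall w, s w = 0}.
Proof.
move=> W1.
have dx : (1 :&: W = 0)%VS.
  apply/eqP; rewrite -subv0; apply/subvP=> x.
  rewrite memv_cap memv0 => /andP[/vlineP[c ->]]; apply: contraTT => nz.
  apply: contra W1 => /(memvZ c^-1); rewrite scalerA mulVf ?scale1r //.
  by apply: contraNneq nz => ->; rewrite scale0r.
pose s x := coord [tuple 1] ord0 (daddv_pi 1%VS W x).
have s_lin : scalar s by move=> a x y; rewrite /s !linearP.
pose sM := GRing.isLinear.Build K L K _ s s_lin.
pose S : {scalar L} := HB.pack s sM.
exists S; split=> [|w Ww] /=; rewrite /s.
  rewrite daddv_pi_id ?mem1v //.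
  have f1 : free [tuple (1 : L)] by rewrite seq1_free oner_neq0.
  by have := @coord_free _ _ _ _ ord0 ord0 f1; rewrite eqxx.
have -> : daddv_pi 1%VS W w = 0; last by rewrite linear0.
have := daddv_pi_add dx (subvP (addvSr _ _) _ Ww).
rewrite capvC in dx; rewrite (daddv_pi_id dx Ww) => e.
by apply: (addIr w); rewrite e add0r.
Qed.

(** In a basis b of L, the square matrices of the s(e_i b_l) and of the coordinates of the e'_j have
    product 1, hence also in reverse order; this says that d is the sum of the s(d e_j) e'_j. *)
Lemma dual_family_complete (I : finType) (s : {scalar L}) (e e' : I -> L) :
  #|I| = \dim {:L} ->
  (forall i j, s (e i * e' j) = (i == j)%:R) ->
  forall c d, \sum_j s (c * e' j) * s (d * e j) = s (c * d).
Proof.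
move=> cardI see'.
have [b bP] : exists b : #|I|.-tuple L, basis_of {:L} b.
  by rewrite cardI; exists (vbasis {:L}); exact: vbasisP.
pose P := \matrix_(i < #|I|, l < #|I|) s (e (enum_val i) * b`_l).
pose Q := \matrix_(l < #|I|, j < #|I|) coord b l (e' (enum_val j)).
have PQ : P *m Q = 1%:M.
  apply/matrixP=> i j; rewrite !mxE -(inj_eq enum_val_inj) -see'.
  rewrite [e' _](coord_basis bP) ?memvf // mulr_sumr linear_sum.
  by apply: eq_bigr => l _; rewrite !mxE -scalerAr linearZ mulrC.
have QP (m : 'I_#|I|) : \sum_j s (e j * b`_m) *: e' j = b`_m :> L.
  transitivity (\sum_(l < #|I|) (Q *m P) l m *: b`_l : L).
    under [RHS]eq_bigr do rewrite mxE scaler_suml.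
    rewrite exchange_big (big_enum_val (A := I)) /=; apply: eq_bigr => j _.
    rewrite {1}[e' _](coord_basis bP) ?memvf // scaler_sumr.
    by apply: eq_bigr => l _; rewrite !mxE scalerA mulrC.
  rewrite (mulmx1C PQ) (bigD1 m) //= mxE eqxx scale1r big1 ?addr0 // => l lm.
  by rewrite mxE (negPf lm) scale0r.
have ee' d : \sum_j s (d * e j) *: e' j = d.
  rewrite [RHS](coord_basis bP) ?memvf //.
  under [RHS]eq_bigr do rewrite -QP scaler_sumr.
  rewrite exchange_big; apply: eq_bigr => j _ /=.
  under [RHS]eq_bigr do rewrite scalerA -linearZ scalerAr.
  rewrite -scaler_suml -linear_sum -mulr_sumr.
  by rewrite -(coord_basis bP) ?memvf // mulrC.
move=> c d; rewrite -[in RHS](ee' d) mulr_sumr linear_sum.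
by apply: eq_bigr => j _; rewrite -scalerAr linearZ mulrC.
Qed.

(** Indexes a basis 1, u_j, v_j of L; [hyp_swap] passes to the dual basis, exchanging u_j with v_j
    and fixing 1. *)
Definition hyp_index k : finType := (unit + ('I_k + 'I_k))%type.

Definition hyp_swap k (i : hyp_index k) : hyp_index k :=
  match i with
  | inl _ => inl tt
  | inr (inl j) => inr (inr j)
  | inr (inr j) => inr (inl j)
  end.

Lemma hyp_swapK k : involutive (@hyp_swap k).
Proof. by case=> [[]|[]]. Qed.

(** The u_j are a basis of a Lagrangian N. Vectors dual to them are made orthogonal to 1, then
    isotropic and mutually orthogonal; this last correction divides by 2. *)
Lemma hyperbolic_basis : 2%:R != 0 :> K -> odd (\dim {:L}) ->
  exists (s : {scalar L}) (k : nat) (e : hyp_index k -> L),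
    [/\ s 1 = 1, forall i j, s (e i * e (hyp_swap j)) = (i == j)%:R
      & forall c d, \sum_j s (c * e (hyp_swap j)) * s (d * e j) = s (c * d)].
Proof.
move=> K2 /exists_lagrangian[N [_ N1 dN]].
have [s [s1 sN]] := scalar_extend1 N1; exists s, (\dim N).
pose u (i : 'I_(\dim N)) : L := (vbasis N)`_i.
have Nu i : u i \in N by rewrite /u vbasis_mem ?mem_nth ?size_tuple.
have su i : s (u i) = 0 by apply/sN/(subvP (addvSl _ _)).
have suu i j : s (u i * u j) = 0.
  by apply/sN/(subvP (addvSr _ _))/memv_mul.
pose b := vbasis {:L}.
pose G := \matrix_(i < \dim N, j < \dim {:L}) s (u i * b`_j).
(* A relation between the rows is some x in N with s(x y) = 0 for all y; if x were nonzero, y = 1/x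
   would give s(1) = 0. *)
have /row_freeP[D GD] : row_free G.
  rewrite -kermx_eq0; apply/rowV0P=> c /sub_kermxP cG; apply/rowP=> i.
  rewrite mxE; set x := \sum_i c 0 i *: u i.
  have sx y : s (x * y) = 0.
    rewrite [y](coord_vbasis (memvf y)) mulr_sumr linear_sum big1 // => j _.
    rewrite -scalerAr linearZ /=.
    have := congr1 (fun M : 'M_(1, _) => M 0 j) cG; rewrite !mxE => Mj.
    rewrite mulr_suml linear_sum (eq_bigr (fun i => c 0 i * G i j)) ?Mj ?mulr0 //.
    by move=> l _; rewrite mxE -scalerAl linearZ.
  have x0 : x = 0.
    apply/eqP/negPn/negP=> nx; have /eqP := sx x^-1.
    by rewrite mulfV // s1 oner_eq0.
  by have /freeP/(_ (fun i => c 0 i) x0) := basis_free (vbasisP N).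
pose w j : L := \sum_l D l j *: b`_l.
have suw i j : s (u i * w j) = (i == j)%:R.
  transitivity ((G *m D) i j); last by rewrite GD mxE.
  rewrite mxE mulr_sumr linear_sum; apply: eq_bigr => l _.
  by rewrite mxE -scalerAr linearZ [RHS]mulrC.
pose v1 j := w j - s (w j) *: 1.
have sv1 j : s (v1 j) = 0 by rewrite linearB linearZ /= s1 mulr1 subrr.
have suv1 i j : s (u i * v1 j) = (i == j)%:R.
  by rewrite mulrBr linearB -scalerAr linearZ mulr1 /= su mulr0 subr0.
(* In s(v_i v_j) each argument removes half of the Gram entry of the [v1]; pairings with N are
   unchanged because s vanishes on N N. *)
pose v j := v1 j - 2%:R^-1 *: \sum_i s (v1 j * v1 i) *: u i.
have sv j : s (v j) = 0.
  rewrite linearB linearZ linear_sum /= sv1 big1 ?mulr0 ?subr0 // => i _.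
  by rewrite linearZ /= su mulr0.
have suv i j : s (u i * v j) = (i == j)%:R.
  rewrite mulrBr linearB -scalerAr linearZ mulr_sumr linear_sum /= suv1.
  rewrite big1 ?mulr0 ?subr0 // => l _.
  by rewrite -scalerAr linearZ /= suu mulr0.
have sv1S i j : s (v1 i * \sum_l s (v1 j * v1 l) *: u l) = s (v1 j * v1 i).
  rewrite mulr_sumr linear_sum (bigD1 i) //= big1 ?addr0 => [|l li].
    by rewrite -scalerAr linearZ /= mulrC mulrC [v1 i * u i]mulrC suv1 eqxx mulr1.
  by rewrite -scalerAr linearZ /= [v1 i * u l]mulrC suv1 (negPf li) mulr0.
have svv i j : s (v i * v j) = 0.
  rewrite {1}/v mulrBl linearB -scalerAl linearZ mulr_suml linear_sum /=.
  rewrite mulrBr linearB -scalerAr linearZ /= sv1S.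
  rewrite (bigD1 j) //= big1 ?addr0 => [|l lj]; last first.
    by rewrite -scalerAl linearZ /= suv (negPf lj) mulr0.
  rewrite -scalerAl linearZ /= suv eqxx mulr1 [v1 j * v1 i]mulrC -addrA -opprD.
  by rewrite -mulrDl -[2%:R^-1]mul1r -mulrDl -(natrD _ 1 1) mulfV // mul1r subrr.
pose e (i : hyp_index (\dim N)) : L :=
  match i with inl _ => 1 | inr (inl j) => u j | inr (inr j) => v j end.
have see i j : s (e i * e (hyp_swap j)) = (i == j)%:R.
  case: i j => [[]|[i|i]] [[]|[j|j]] //=;
    by rewrite ?mul1r ?mulr1 // [v i * u j]mulrC suv eq_sym.
exists e; split=> //; apply: dual_family_complete see.
by rewrite !card_sum card_unit card_ord addnn -dN.
Qed.

End TraceForm.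

(** * Finite powers of an object *)

Section Powers.
Variable C : addCat.
Implicit Types A B D P Q : C.

Lemma comp_suml (I : finType) A B D (g : I -> hom B D) (f : hom A B) :
  (\sum_i g i) \oc f = \sum_i g i \oc f.
Proof. exact: (big_morph (fun g : hom B D => g \oc f) (fun g g' => compDl g g' f) (@comp0m C A B D f)). Qed.

Lemma comp_sumr (I : finType) A B D (g : hom B D) (f : I -> hom A B) :
  g \oc (\sum_i f i) = \sum_i g \oc f i.
Proof. exact: (big_morph _ (compDr g) (@compm0 C A B D g)). Qed.

Lemma compNm A B D (g : hom B D) (f : hom A B) : (- g) \oc f = - (g \oc f).
Proof. by apply: (addrI (g \oc f)); rewrite -compDl !subrr comp0m. Qed.

Lemma compmN A B D (g : hom B D) (f : hom A B) : g \oc (- f) = - (g \oc f).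
Proof. by apply: (addrI (g \oc f)); rewrite -compDr !subrr compm0. Qed.

(** P is the direct sum of copies of A indexed by I. Keeping the structure maps as data treats alike
    the various bracketings of binary biproducts. *)
Definition is_power (I : finType) A P
    (inj : I -> hom A P) (prj : I -> hom P A) :=
  (forall i j, prj i \oc inj j = if i == j then idm A else 0)
  /\ \sum_i inj i \oc prj i = idm P.

Lemma is_power_unit A : is_power (fun _ : unit => idm A) (fun=> idm A).
Proof.
split=> [[] []|]; first by rewrite comp1m.
by rewrite (big_pred1 tt) ?comp1m // => -[].
Qed.

Definition sum_inj (I J : finType) A P Q
    (inj : I -> hom A P) (inj' : J -> hom A Q) (i : I + J) : hom A (bip P Q) :=
  match i with inl j => in1 P Q \oc inj j | inr j => in2 P Q \oc inj' j end.

Definition sum_prj (I J : finType) A P Q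
    (prj : I -> hom P A) (prj' : J -> hom Q A) (i : I + J) : hom (bip P Q) A :=
  match i with inl j => prj j \oc pr1 P Q | inr j => prj' j \oc pr2 P Q end.

Lemma is_power_bip (I J : finType) A P Q
    (inj : I -> hom A P) prj (inj' : J -> hom A Q) prj' :
  is_power inj prj -> is_power inj' prj' ->
  is_power (sum_inj inj inj') (sum_prj prj prj').
Proof.
move=> [pi1 ip1] [pi2 ip2]; split.
  move=> [i|i] [j|j] /=; rewrite compA -(compA (_ i)).
  - by rewrite pr1_in1 compm1 pi1.
  - by rewrite pr1_in2 compm0 comp0m.
  - by rewrite pr2_in1 compm0 comp0m.
  - by rewrite pr2_in2 compm1 pi2.
rewrite big_sumType /= -bip_id; congr (_ + _).
  rewrite -[in1 P Q in RHS]compm1 -ip1 comp_sumr comp_suml.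
  by apply: eq_bigr => i _; rewrite !compA.
rewrite -[in2 P Q in RHS]compm1 -ip2 comp_sumr comp_suml.
by apply: eq_bigr => i _; rewrite !compA.
Qed.

Lemma is_power_recl k A P (inj : 'I_k -> hom A P) prj :
  is_power inj prj ->
  is_power (fun i : 'I_k.+1 => if unlift ord0 i is Some j
                               then in2 A P \oc inj j else in1 A P)
           (fun i : 'I_k.+1 => if unlift ord0 i is Some j
                               then prj j \oc pr2 A P else pr1 A P).
Proof.
move=> [pi ip]; split.
  move=> i j; case: unliftP => [i'|] ->; case: unliftP => [j'|] ->.
  - rewrite (inj_eq lift_inj) -pi compA -(compA (prj i')).
    by rewrite pr2_in2 compm1.
  - by rewrite -compA pr2_in1 compm0.
  - by rewrite compA pr1_in2 comp0m.
  - by rewrite eqxx pr1_in1.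
rewrite big_ord_recl unlift_none -bip_id; congr (_ + _).
rewrite -[in2 A P in RHS]compm1 -ip comp_sumr comp_suml.
by apply: eq_bigr => i _; rewrite liftK !compA.
Qed.

End Powers.

(** * Orthogonal multiples, hyperbolic forms and opposites *)

Section HermitianForms.
Variables (C : hermCat) (eps : int).
Implicit Types A P Q : C.

Lemma dualm_sum (I : finType) A P (f : I -> hom A P) :
  dualm (\sum_i f i) = \sum_i dualm (f i).
Proof. exact: (big_morph _ (@dualmD C A P) (@dualm0 C A P)). Qed.

Lemma hf_power (s : hform C eps) k :
  exists (t : hform C eps) (inj : 'I_k -> hom (sobj s) (sobj t)) prj,
    is_power inj prj /\ smap t = \sum_i dualm (prj i) \oc smap s \oc prj i.
Proof.
elim: k => [|k [t [inj [prj [ip e]]]]].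
  exists (hf_zero C eps), (fun=> 0), (fun=> 0); split=> [|/=].
    by split=> [[]|] //; rewrite big_ord0 /= idm_zobj.
  by rewrite big_ord0.
exists (hf_sum s t); have := is_power_recl ip.
set inj' := fun i => _; set prj' := fun i => _ => ip'.
exists inj', prj'; split=> //=; rewrite big_ord_recl /prj' unlift_none.
congr (_ + _); rewrite e comp_sumr comp_suml; apply: eq_bigr => i _.
by rewrite liftK dualmM !compA.
Qed.

(** [adjoint s] is the dual of s composed with omega, and both it and the dual of s are
    invertible. *)
Lemma unimodular_reflexive (s : sform C) :
  unimodular s -> reflexive_obj (sobj s).
Proof.
move=> [[g [gs sg]] [h [h1 h2]]]; exists (h \oc dualm (smap s)); split.
  by rewrite -compA.
suff -> : omega (sobj s) \oc (h \oc dualm (smap s))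
    = dualm g \oc (adjoint s \oc h) \oc dualm (smap s).
  by rewrite h2 compm1 -dualmM sg dualm1.
by rewrite /adjoint !compA -dualmM sg dualm1 comp1m.
Qed.

Lemma pull_hyp_form D Q (p : hom D Q) (q : hom D (dual Q)) :
  dualm (pair_m p q) \oc smap (hyp_form eps Q) \oc pair_m p q
  = dualm p \oc q + (dualm q \oc omega Q \oc p) *~ eps.
Proof.
rewrite /= compDr compDl compMzr compMzl.
rewrite !compA -!dualmM pr1_pair pr2_pair -!compA pr1_pair pr2_pair.
by rewrite !compA.
Qed.

(** The tensor product of s with the hyperbolic plane; each pair u_j, v_j contributes such a block
    to a transfer. *)
Definition offdiag_form (s : sform C) : sform C :=
  let A := sobj s in
  @SForm C (bip A A) (dualm (pr1 A A) \oc smap s \oc pr2 A A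
                      + dualm (pr2 A A) \oc smap s \oc pr1 A A).

(** The isometry is the identity on the first summand and s on the second; hermitian symmetry turns
    eps times the adjoint of s back into s. *)
Lemma offdiag_hyperbolic (s : hform C eps) :
  isometric (offdiag_form s) (hyp_form eps (sobj s)).
Proof.
have [[g [gs sg]] _] := hf_unimodular s.
exists (pair_m (pr1 _ _) (smap s \oc pr2 _ _)); split.
  exists (pair_m (pr1 _ _) (g \oc pr2 _ _)); split; apply: bip_ext.
  - by rewrite compA !pr1_pair compm1.
  - by rewrite compA pr2_pair -compA pr2_pair compA gs comp1m compm1.
  - by rewrite compA !pr1_pair compm1.
  - by rewrite compA pr2_pair -compA pr2_pair compA sg comp1m compm1.
rewrite pull_hyp_form /= !compA; congr (_ + _).
rewrite {1}hf_hermitian /adjoint dualmM.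
by rewrite compMzr compMzl !compA.
Qed.

Lemma dualmN A P (f : hom A P) : dualm (- f) = - dualm f.
Proof. by apply: (addrI (dualm f)); rewrite -dualmD !subrr dualm0. Qed.

Lemma adjoint_opp (s : sform C) : adjoint (SForm (- smap s)) = - adjoint s.
Proof. by rewrite /adjoint /= dualmN compNm. Qed.

Lemma opp_unimodular (s : sform C) :
  unimodular s -> unimodular (SForm (- smap s)).
Proof.
have opp_iso A B (f : hom A B) : is_iso f -> is_iso (- f).
  by move=> [g [gf fg]]; exists (- g); rewrite !compNm !compmN !opprK.
by move=> [h h']; split; [|rewrite adjoint_opp]; apply: opp_iso.
Qed.

Lemma opp_hermitian (s : sform C) :
  eps_hermitian eps s -> eps_hermitian eps (SForm (- smap s)).
Proof. by rewrite /eps_hermitian adjoint_opp mulNrz /= => {1}->. Qed.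

Definition hf_opp (s : hform C eps) : hform C eps :=
  HForm (opp_unimodular (hf_unimodular s)) (opp_hermitian (hf_hermitian s)).

Hypothesis halves : forall A, exists z : hom A A, z + z = idm A.

Lemma hom_double_eq0 A P (f : hom A P) : f + f = 0 -> f = 0.
Proof.
have [z zz] := halves A => ff.
by rewrite -[f]compm1 -zz compDr -compDl ff comp0m.
Qed.

(** Under (a, b) -> ((a + b)/2, s(a - b)) the mixed terms cancel. [halves] expresses division by 2
    without scalars, so that this applies to [scalar_ext], a mere [hermCat]. *)
Lemma hf_opp_hyperbolic (s : hform C eps) : hyperbolic eps (hf_sum s (hf_opp s)).
Proof.
exists (sobj s); first exact/unimodular_reflexive/hf_unimodular.
have [[g [gs sg]] _] := hf_unimodular s.
set A := sobj s; have [z zz] := halves A.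
pose a := pr1 A A; pose b := pr2 A A.
have zC D (f : hom D A) : z \oc f + z \oc f = f by rewrite -compDl zz comp1m.
have eq_double D P (f f' : hom D P) : f + f = f' + f' -> f = f'.
  move=> ff; apply/eqP; rewrite -subr_eq0; apply/eqP/hom_double_eq0.
  by rewrite addrACA ff -opprD subrr.
exists (pair_m (z \oc (a + b)) (smap s \oc (a - b))); split.
  exists (pair_m (pr1 _ _ + z \oc (g \oc pr2 _ _))
                 (pr1 _ _ - z \oc (g \oc pr2 _ _))); split; apply: bip_ext.
  - rewrite compA pr1_pair compDl pr1_pair -!compA pr2_pair.
    rewrite [g \oc _]compA gs comp1m -compDr addrACA subrr addr0 compDr zC.
    by rewrite compm1.
  - rewrite compA pr2_pair compDl compNm pr1_pair -!compA pr2_pair.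
    rewrite [g \oc _]compA gs comp1m -compmN -compDr opprD opprK.
    by rewrite addrACA subrr add0r compDr zC compm1.
  - rewrite compA pr1_pair -compA compDl pr1_pair pr2_pair.
    by rewrite addrACA subrr addr0 compDr zC compm1.
  rewrite compA pr2_pair -compA compDl compNm pr1_pair pr2_pair.
  rewrite opprD opprK addrACA subrr add0r zC compA sg comp1m compm1 //.
rewrite pull_hyp_form /= -/a -/b; apply: eq_double; apply/esym.
set x := a + b; set y := a - b.
transitivity (dualm x \oc smap s \oc y + dualm y \oc smap s \oc x).
  rewrite addrACA; congr (_ + _).
    by rewrite -compDl -dualmD zC compA.
  rewrite -mulrzDl -compDr zC [in RHS]hf_hermitian /adjoint dualmM.
  by rewrite compMzr compMzl !compA.
rewrite /x /y !dualmD !dualmN !compDl !compDr !compNm !compmN.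
rewrite ?compNm [LHS](AC ((2*2)*(2*2)) ((1*4)*(5*8)*((2*6)*(3*7)))) /=.
by rewrite addNr subrr !addr0.
Qed.

End HermitianForms.

(** * Trace maps on the Hom groups of the extended category *)

Section ScalarExtensionTrace.
Variables (K : fieldType) (L : fieldExtType K) (C : linHermCat K).
Variable s : {scalar L}.
Implicit Types A B D P Q : C.

Lemma hscale0 A B (f : hom A B) : hscale 0 f = 0.
Proof. exact: (scale0r (f : lhom A B)). Qed.

Lemma hscale_sum (I : finType) A B (c : I -> K) (f : hom A B) :
  hscale (\sum_i c i) f = \sum_i hscale (c i) f.
Proof. exact: (scaler_suml (f : lhom A B)). Qed.

(* The map id (x) s(c -) : Hom(A, B) (x) L -> Hom(A, B). *)
Definition ext_trace A B (c : L) (x : ext_hom L A B) : hom A B :=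
  tens_lift (fun (f : lhom A B) (a : L) => hscale (s (c * a)) f) x.

Lemma ext_trace_balanced A B c :
  balanced (fun (f : lhom A B) (a : L) => hscale (s (c * a)) f).
Proof.
split=> [f f' a|f a a'|k f a].
- exact: hscaleDr.
- by rewrite mulrDr linearD hscaleDl.
- by rewrite [LHS]hscaleA -scalerAr linearZ mulrC.
Qed.

Lemma ext_trace_tens A B c (f : hom A B) a :
  ext_trace c (ext_tens f a) = hscale (s (c * a)) f.
Proof. exact: (tens_liftE (ext_trace_balanced A B c)). Qed.

Lemma ext_traceD A B c (x y : ext_hom L A B) :
  ext_trace c (x + y) = ext_trace c x + ext_trace c y.
Proof. exact: (tens_liftD (ext_trace_balanced A B c)). Qed.

Lemma ext_trace0 A B c : ext_trace c (0 : ext_hom L A B) = 0.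
Proof. by apply: (addrI (ext_trace c 0)); rewrite -ext_traceD !addr0. Qed.

Lemma ext_trace_dual A B c (x : ext_hom L A B) :
  ext_trace c (ext_dualm x) = dualm (ext_trace c x).
Proof.
elim/ext_ind: x => [|x y ihx ihy|f a].
- by rewrite ext_dualm0 !ext_trace0 dualm0.
- by rewrite ext_dualmD !ext_traceD ihx ihy dualmD.
by rewrite ext_dualm_tens !ext_trace_tens dualm_scale.
Qed.

Lemma ext_trace_compl A B D c (g : hom B D) (x : ext_hom L A B) :
  ext_trace c (ext_comp (ext_tens g 1) x) = g \oc ext_trace c x.
Proof.
elim/ext_ind: x => [|x y ihx ihy|f a].
- by rewrite ext_comp0r !ext_trace0 compm0.
- by rewrite ext_compDr !ext_traceD ihx ihy compDr.
by rewrite ext_comp_tens !ext_trace_tens mul1r comp_scaler.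
Qed.

Lemma ext_trace_compr A B D c (y : ext_hom L B D) (f : hom A B) :
  ext_trace c (ext_comp y (ext_tens f 1)) = ext_trace c y \oc f.
Proof.
elim/ext_ind: y => [|x y ihx ihy|g a].
- by rewrite ext_comp0l !ext_trace0 comp0m.
- by rewrite ext_compDl !ext_traceD ihx ihy compDl.
by rewrite ext_comp_tens !ext_trace_tens mulr1 comp_scalel.
Qed.

(** [ext_trace 1] commutes with composition by morphisms of C and sends id (x) 1 to s(1) id, so it
    carries the inverse over L to an inverse over K. *)
Lemma is_iso_ext A B (f : hom A B) :
  s 1 = 1 -> @is_iso (scalar_ext L C) A B (ext_tens f 1) -> is_iso f.
Proof.
move=> s1 [g [gf fg]]; exists (ext_trace 1 g).
rewrite -ext_trace_compl -ext_trace_compr.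
by split; [move: gf | move: fg] => /= ->;
  rewrite ext_trace_tens mulr1 s1 hscale1.
Qed.

(** * Transfer of morphisms and of isometries *)

Section Transfer.
Variables (I : finType) (e : I -> L) (sw : I -> I).
Hypothesis swK : involutive sw.
Hypothesis see : forall i j, s (e i * e (sw j)) = (i == j)%:R.
Hypothesis sewe : forall c d,
  \sum_j s (c * e (sw j)) * s (d * e j) = s (c * d).

(** Both sides are biadditive, and on pure tensors this is the relation [sewe]. It is the matrix
    product rule behind [transfer_comp]. *)
Lemma ext_trace_comp A B D c d (y : ext_hom L B D) (x : ext_hom L A B) :
  \sum_j ext_trace (c * e (sw j)) y \oc ext_trace (d * e j) x
  = ext_trace (c * d) (ext_comp y x).
Proof.
elim/ext_ind: y => [|y y' ih ih'|g b].
- rewrite ext_comp0l ext_trace0 big1 // => j _.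
  by rewrite ext_trace0 comp0m.
- rewrite ext_compDl ext_traceD -ih -ih' -big_split; apply: eq_bigr => j _.
  by rewrite ext_traceD compDl.
elim/ext_ind: x => [|x x' ih ih'|f a].
- rewrite ext_comp0r ext_trace0 big1 // => j _.
  by rewrite ext_trace0 compm0.
- rewrite ext_compDr ext_traceD -ih -ih' -big_split; apply: eq_bigr => j _.
  by rewrite ext_traceD compDr.
rewrite ext_comp_tens ext_trace_tens.
rewrite (_ : c * d * (b * a) = (c * b) * (d * a)); last by rewrite mulrACA.
rewrite -sewe hscale_sum; apply: eq_bigr => j _.
rewrite !ext_trace_tens comp_scalel comp_scaler hscaleA.
by rewrite -!(mulrAC _ _ (e _)).
Qed.

(** Restriction of scalars: on f (x) a, it is f times the matrix of multiplication by a in the basis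
    e, whose dual basis is [e (sw j)]. *)
Definition transfer A B P Q (inj : I -> hom B Q) (prj : I -> hom P A)
    (x : ext_hom L A B) : hom P Q :=
  \sum_j inj j \oc \sum_i ext_trace (e i * e (sw j)) x \oc prj i.

Lemma prj_transfer A B P Q (inj : I -> hom B Q) (prj : I -> hom P A) prj'
    (x : ext_hom L A B) j :
  is_power inj prj' ->
  prj' j \oc transfer inj prj x
  = \sum_i ext_trace (e i * e (sw j)) x \oc prj i.
Proof.
move=> [pi ip]; rewrite comp_sumr (bigD1 j) //= compA pi eqxx comp1m.
rewrite [X in _ + X]big1 ?addr0 // => i ij.
by rewrite compA pi eq_sym (negPf ij) comp0m.
Qed.

Lemma transfer_comp A B D P Q R (inj : I -> hom B Q) prj
    (prj' : I -> hom P A) (inj' : I -> hom D R)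
    (y : ext_hom L B D) (x : ext_hom L A B) :
  is_power inj prj ->
  transfer inj' prj y \oc transfer inj prj' x
  = transfer inj' prj' (ext_comp y x).
Proof.
move=> ip; rewrite comp_suml; apply: eq_bigr => j _.
rewrite -compA comp_suml; congr (_ \oc _).
under eq_bigr do rewrite -compA (prj_transfer _ _ _ ip) comp_sumr.
rewrite exchange_big; apply: eq_bigr => l _ /=.
under eq_bigr do rewrite compA.
rewrite -comp_suml; congr (_ \oc _).
rewrite [e l * _]mulrC -ext_trace_comp (reindex_inj (inv_inj swK)).
by apply: eq_bigr => i _; rewrite [e (sw i) * _]mulrC swK.
Qed.

Lemma transfer_id A P (inj : I -> hom A P) prj :
  is_power inj prj -> transfer inj prj (ext_tens (idm A) 1) = idm P.
Proof.
move=> [_ <-]; apply: eq_bigr => j _; congr (_ \oc _).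
rewrite (bigD1 j) //= ext_trace_tens mulr1 see eqxx hscale1 comp1m.
rewrite big1 ?addr0 // => i ij.
by rewrite ext_trace_tens mulr1 see (negPf ij) hscale0 comp0m.
Qed.

(* The Gram matrix of (x, y) |-> s(x y) in the basis e is the permutation matrix
   of sw, so this is the form s(x y) (x) phi. *)
Definition transfer_form A P (prj : I -> hom P A) (phi : hom A (dual A)) :
    sform C :=
  SForm (\sum_i dualm (prj i) \oc phi \oc prj (sw i)).

(** By functoriality the transfer T of the isometry x is invertible. Pulled back along T, the form
    of g has as (i, l) block the trace, with factor e_i e_l, of the pullback of g_L along x, which
    is f_L; this block is s(e_i e_l) f. *)
Lemma transfer_isometric (f g : sform C) P Q
    (inj : I -> hom (sobj f) P) prj (inj' : I -> hom (sobj g) Q) prj' :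
  is_power inj prj -> is_power inj' prj' ->
  isometric (ext_form L f) (ext_form L g) ->
  isometric (transfer_form prj (smap f)) (transfer_form prj' (smap g)).
Proof.
move=> ip ip' [x [[y [/= yx xy]] /= fE]].
have prjT j := prj_transfer prj x j ip'.
have isoT : is_iso (transfer inj' prj x).
  exists (transfer inj prj' y).
  by rewrite (transfer_comp _ _ _ _ ip') (transfer_comp _ _ _ _ ip) yx xy
             !transfer_id.
move: (transfer _ _ _) prjT isoT => T prjT isoT; exists T; split=> //.
rewrite /= comp_sumr comp_suml.
under [RHS]eq_bigr do rewrite !compA -dualmM -!compA !prjT.
transitivity (\sum_j \sum_i \sum_l dualm (prj i) \oc
    (ext_trace (e i * e (sw j)) (ext_dualm x) \oc
     ext_trace (e l * e j) (ext_comp (ext_tens (smap g) 1) x)) \oc prj l);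
  last first.
  apply: eq_bigr => j _; rewrite dualm_sum comp_suml; apply: eq_bigr => i _.
  rewrite !comp_sumr; apply: eq_bigr => l _.
  by rewrite dualmM ext_trace_dual ext_trace_compl swK !compA.
rewrite exchange_big.
transitivity (\sum_i \sum_l dualm (prj i) \oc
    hscale (s (e i * e l)) (smap f) \oc prj l); last first.
  apply: eq_bigr => i _; rewrite exchange_big; apply: eq_bigr => l _ /=.
  by rewrite -comp_suml -comp_sumr ext_trace_comp ext_compA -fE
             ext_trace_tens mulr1.
apply: eq_bigr => i _.
(* By [see], s(e_i e_l) is 1 for l = sw i and 0 otherwise. *)
rewrite (bigD1 (sw i)) //= see eqxx hscale1 big1 ?addr0 // => l li.
have -> : s (e i * e l) = 0.
  rewrite -[l]swK see; case: eqP => // il; case/eqP: li.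
  by rewrite il swK.
by rewrite hscale0 compm0 comp0m.
Qed.

End Transfer.
End ScalarExtensionTrace.

(** * Descent from L to K and the kernel of the extension map *)

Section Descent.
Variables (K : fieldType) (L : fieldExtType K) (eps : int) (C : linHermCat K).
Hypothesis K2 : 2%:R != 0 :> K.
Hypothesis oddL : odd (\dim {:L}).
Hypothesis heps : eps = 1 \/ eps = -1.

(** The basis element 1 carries f; the u_j and v_j together carry [offdiag_form] of the k-fold
    multiple of f, which is hyperbolic. *)
Lemma transfer_form_decomp (f : hform C eps) k :
  exists (Q : C) (inj : hyp_index k -> hom (sobj f) Q) prj (h : hform C eps),
    [/\ is_power inj prj, hyperbolic eps h
      & isometric (transfer_form (@hyp_swap k) prj (smap f)) (orth_sum f h)].
Proof.
have [t [inj [prj [ip tE]]]] := hf_power f k.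
have Pr := unimodular_reflexive (hf_unimodular t).
pose h : hform C eps :=
  HForm (hyp_form_unimodular heps Pr) (hyp_form_hermitian (sobj t) heps).
have ip' := is_power_bip (is_power_unit (sobj f)) (is_power_bip ip ip).
do 3!eexists; exists h; split; first exact: ip'.
  by exists (sobj t) => //; apply: isometric_refl.
apply: isometric_trans (orth_sum_isometric (isometric_refl _)
                                           (offdiag_hyperbolic t)).
rewrite (_ : transfer_form _ _ _ = orth_sum f (offdiag_form t)).
  exact: isometric_refl.
congr SForm; rewrite !big_sumType /= (big_pred1 tt) => [|[] //].
rewrite /= !comp1m; congr (_ + _).
by rewrite tE compDr compDl; congr (_ + _);
  rewrite !(comp_sumr, comp_suml); apply: eq_bigr => i _; rewrite !dualmM !compA.
Qed.

(** Transfer makes f + h isometric to g + h' with h and h' hyperbolic, so the difference is h' -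
    h. *)
Lemma ext_isometric_hyp_span (f g : hform C eps) :
  isometric (ext_form L f) (ext_form L g) ->
  groth_in (iso_class f) - groth_in (iso_class g) \in hyp_span C eps.
Proof.
move=> fg; have [s [k [e [_ see sewe]]]] := hyperbolic_basis K2 oddL.
have [P [inj [prj [h [ip hh fE]]]]] := transfer_form_decomp f k.
have [Q [inj' [prj' [h' [ip' hh' gE]]]]] := transfer_form_decomp g k.
have := transfer_isometric (@hyp_swapK k) see sewe ip ip' fg.
move=> /(isometric_trans (isometric_sym fE)) /isometric_trans /(_ gE).
move=> /(iso_classP (hf_sum f h) (hf_sum g h')).
rewrite !iso_classD => /(congr1 (@groth_in _)); rewrite !groth_inD => fh.
rewrite (_ : _ - _ = groth_in (iso_class h') - groth_in (iso_class h)).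
  by rewrite rpredB ?hyp_span_hyp.
by apply/eqP; rewrite subr_eq addrAC eq_sym subr_eq fh addrC.
Qed.

(** The object Q of the hyperbolic form is already an object of C, and its reflexivity descends by
    [is_iso_ext]. *)
Lemma hyperbolic_descent (h : hform (scalar_ext L C) eps) :
  hyperbolic eps h ->
  exists2 h' : hform C eps, hyperbolic eps h'
    & iso_class h = iso_class (ext_hform L h').
Proof.
move=> [Q Qr hQ]; have [s [_ [_ [s1 _ _]]]] := hyperbolic_basis K2 oddL.
have Qr' : reflexive_obj (Q : C) := is_iso_ext s1 Qr.
exists (HForm (hyp_form_unimodular heps Qr') (hyp_form_hermitian (Q : C) heps)).
  by exists (Q : C) => //; apply: isometric_refl.
by apply/iso_classP; rewrite /= ext_hyp_form.
Qed.

Lemma hyp_span_descent x : x \in hyp_span (scalar_ext L C) eps ->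
  exists2 y, y \in hyp_span C eps & x = groth_map (iso_ext L (eps := eps)) y.
Proof.
pose S := fun x => `[< exists2 y , y \in hyp_span C eps
                       & x = groth_map (@iso_ext K L C eps) y>].
move/hyp_spanP/(_ S) => h; apply/asboolP; apply: h.
  split; first by apply/asboolP; exists 0; rewrite ?rpred0 ?raddf0.
  move=> a b /asboolP[a' Ha ->] /asboolP[b' Hb ->]; apply/asboolP.
  by exists (a' - b'); rewrite ?rpredB ?raddfB.
move=> f /hyperbolic_descent[f' hf' ->]; apply/asboolP.
exists (groth_in (iso_class f')); first exact: hyp_span_hyp.
by rewrite groth_map_in /= iso_extE.
Qed.

(** Vanishing of f - g over L only gives f_L + k = g_L + k for some k over C_L. Adding -k replaces k
    by the hyperbolic form k - k, which descends, so [ext_isometric_hyp_span] applies. *)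
Lemma groth_map_ext_ker x :
  groth_map (@iso_ext K L C eps) x = 0 -> x \in hyp_span C eps.
Proof.
have [a [b ->]] := gdiff_surj x.
have [f ->] := iso_class_surj a; have [g ->] := iso_class_surj b.
rewrite groth_mapE /= => /gdiffP[c]; rewrite addr0 add0r.
have [k ->] := iso_class_surj c => /(congr1 (+%R^~ (iso_class (hf_opp k)))).
have halves (A : scalar_ext L C) : exists z : hom A A, z + z = idm A.
  exists (ext_tens (idm (A : C)) (2%:R^-1)%:A).
  rewrite -ext_tensDr -scalerDl -[2%:R^-1]mul1r -mulrDl -(natrD _ 1 1) mulfV //.
  by rewrite scale1r.
have [h hh kE] := hyperbolic_descent (hf_opp_hyperbolic halves k).
rewrite -!addrA -(iso_classD k (hf_opp k)) kE !iso_extE -!iso_classD => /iso_classP.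
rewrite /= -!ext_orth_sum => fg.
have := @ext_isometric_hyp_span (hf_sum f h) (hf_sum g h) fg.
by rewrite !iso_classD !groth_inD opprD addrACA subrr addr0 -gdiffE.
Qed.

End Descent.

Theorem theorem5p19 (K : fieldType) (L : fieldExtType K) (eps : int)
    (C : linHermCat K)
    (hK : 2%N \notin [pchar K])
    (hL : odd (\dim {:L}))
    (heps : eps = 1 \/ eps = -1)
    (hC : forall M M' : C, finite_dim (lhom M M')) :
  injective (witt_ext L C eps).
Proof.
have K2 : 2%:R != 0 :> K by move: hK; rewrite inE /=.
apply: raddf_inj => x; rewrite -[x]witt_repK /= witt_ext_of.
rewrite -[RHS](raddf0 (@witt_of _ eps)) => /witt_ofP; rewrite subr0.
(* The image of the representative of x is also the image of some h in [hyp_span]; their difference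
   then dies already in the Grothendieck group over L. *)
move=> /(hyp_span_descent K2 hL heps)[h hh xE].
rewrite -(raddf0 (@witt_of C eps)); apply/witt_ofP; rewrite subr0.
rewrite -[witt_rep x](subrK h) rpredD //.
by apply: (groth_map_ext_ker K2 hL heps); rewrite raddfB /= -xE subrr.
Qed.
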